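(* Assume any prior $\pi(d\theta)$ for $\theta$. Then the posterior mean of a unimodal density $f(t|G,\theta)$ (model in the context), given $N$ i.i.d. observations $\mathbf{T}=(T_1,\dots,T_N)$ from it, is $$\mathbb{E}[f(t|G,\theta)|\mathbf{T}]=\int_{\mathbb{R}}\sum_{\mathbf{S}^+}\sum_{\mathbf{S}^-}a_f(t|\mathbf{S}^-,\mathbf{S}^+,\theta,\mathbf{T})\,\pi(\mathbf{S}^-,\mathbf{S}^+,d\theta|\mathbf{T}),$$ where, for each $\theta$, the sums run over all $\mathbf{S}$-paths $\mathbf{S}^+$ of $n+1$ coordinates and $\mathbf{S}^-$ of $N-n+1$ coordinates ($n$ being the number of $k$ with $T_k>\theta$), and $a_f(t|\mathbf{S}^-,\mathbf{S}^+,\theta,\mathbf{T})$ and $\pi(\mathbf{S}^-,\mathbf{S}^+,d\theta|\mathbf{T})$ are defined in the context.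
   Context: Species sampling model. $G$ is a random probability measure on $\mathbb{R}$ of the form $G(\cdot)=\sum_k W_k\delta_{\xi_k}(\cdot)+(1-\sum_kW_k)H(\cdot)$, where $H$ is a non-atomic probability measure on $\mathbb{R}$, the $\xi_k$ are i.i.d. $H$, and the random weights $0<W_k<1$, $\sum_kW_k\le1$, are independent of the $\xi_k$. If $X_1,\dots,X_N$ are i.i.d. from $G$ given $G$, with partition $\mathbf{p}=\{C_1,\dots,C_{N(\mathbf{p})}\}$ of $\{1,\dots,N\}$ into the classes of equal values, $C_k=\{j:X_j=X_k^*\}$, $X_k^*$ the unique values, $e_k=|C_k|$, then the joint law of $(X_1,\dots,X_N)$ is $\pi(\mathbf{p})\prod_{k=1}^{N(\mathbf{p})}H(dX_k^* )$ with $\pi(\mathbf{p})=\chi(e_1,\dots,e_{N(\mathbf{p})})$. Here $\chi$ is a symmetric function of finite lists of positive integers (the exchangeable partition probability function of $G$, defined for every sample size); $\chi$ of the empty list is $1$. Model. $\theta$ is a real random variable with prior probability distribution $\pi(d\theta)$, independent of $G$. Given $G$ and $\theta$, the $T_k$ are i.i.d. with density $f(t|G,\theta)=\int X^{-1}[\mathbb{I}(0<t-\theta\le X)-\mathbb{I}(X\le t-\theta<0)]\,G(dX)$, $t\in\mathbb{R}$. $\mathbb{I}$ is the indicator. Ordering. For each $\theta$, the values $T_1-\theta,\dots,T_N-\theta$ are (almost surely) distinct and nonzero and are listed as $\mathbf{Z}=(Z_{N-n},\dots,Z_1)$, $Z_{N-n}<\dots<Z_1<0$, and $\mathbf{Y}=(Y_1,\dots,Y_n)$,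 $0<Y_1<\dots<Y_n$; so $n$, $\mathbf{Y}$, $\mathbf{Z}$ depend on $\theta$ and $\mathbf{T}$. (For $\theta\in\{T_1,\dots,T_N\}$ the likelihood is zero and the integrand is taken to be $0$.) $\mathbf{S}$-paths. An $\mathbf{S}$-path of $n+1$ coordinates is an integer vector $\mathbf{S}=(S_0,\dots,S_n)$ with $S_0=0$, $S_n=n$, $S_j\le j$ and $S_j\le S_{j+1}$ for $j=1,\dots,n-1$. A partition of $\{1,\dots,n\}$ corresponds to $\mathbf{S}$ if the maximal elements of its cells are exactly the $j$ with $S_j>S_{j-1}$ and the cell with maximal element $j$ has size $S_j-S_{j-1}$. $\mathbb{C}_{\mathbf{S}}$ is the set of partitions corresponding to $\mathbf{S}$; $|\mathbb{C}_{\mathbf{S}}|=\prod_{j:S_j>S_{j-1}}\binom{j-1-S_{j-1}}{j-S_j}$. $\mathcal{M}_{a,b}(\mathbf{S})$ is the list (multiset) $\{S_j-S_{j-1}:S_j>S_{j-1},\ a\le j\le b\}$; $\chi(\mathcal{M},\mathcal{M}')$ is $\chi$ evaluated at the concatenated list, and $\mathcal{M}\backslash\{m\}$ removes one copy of $m$. Joint posterior of paths and mode. $$\pi(\mathbf{S}^-,\mathbf{S}^+,d\theta|\mathbf{T})=\frac{\phi^+_\theta(\mathbf{S}^+,\mathbf{T})\,\phi^-_\theta(\mathbf{S}^-,\mathbf{S}^+,\mathbf{T})\,\pi(d\theta)}{\int_{\mathbb{R}}\sum_{\mathbf{S}^+}\sum_{\mathbf{S}^-}\phi^+_\vartheta(\mathbf{S}^+,\mathbf{T})\,\phi^-_\vartheta(\mathbf{S}^-,\mathbf{S}^+,\mathbf{T})\,\pi(d\vartheta)},$$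 with $$\phi^+_\theta(\mathbf{S}^+,\mathbf{T})=|\mathbb{C}_{\mathbf{S}^+}|\,\chi(\mathcal{M}_{1,n}(\mathbf{S}^+))\prod_{j:S_j^+>S_{j-1}^+}\int_{Y_j}^{\infty}U^{-(S_j^+-S_{j-1}^+)}H(dU),$$ $$\phi^-_\theta(\mathbf{S}^-,\mathbf{S}^+,\mathbf{T})=|\mathbb{C}_{\mathbf{S}^-}|\,\frac{\chi(\mathcal{M}_{1,n}(\mathbf{S}^+),\mathcal{M}_{1,N-n}(\mathbf{S}^-))}{\chi(\mathcal{M}_{1,n}(\mathbf{S}^+))}\prod_{j:S_j^->S_{j-1}^-}\int_{-\infty}^{Z_j}(-V)^{-(S_j^--S_{j-1}^-)}H(dV).$$ Prediction weights. With $D=\chi(\mathcal{M}_{1,n}(\mathbf{S}^+),\mathcal{M}_{1,N-n}(\mathbf{S}^-))$, $$\eta_0(\mathbf{S}^+,\mathbf{S}^-)=\chi(\mathcal{M}_{1,n}(\mathbf{S}^+),\mathcal{M}_{1,N-n}(\mathbf{S}^-),1)/D;$$ for $j=1,\dots,n$, $\eta_j^+(\mathbf{S}^+,\mathbf{S}^-)=\chi(\mathcal{M}_{1,n}(\mathbf{S}^+)\backslash\{S_j^+-S_{j-1}^+\},\mathcal{M}_{1,N-n}(\mathbf{S}^-),S_j^+-S_{j-1}^++1)/D$ if $S_j^+>S_{j-1}^+$, and $0$ otherwise; for $j=1,\dots,N-n$, $\eta_j^-(\mathbf{S}^+,\mathbf{S}^-)=\chi(\mathcal{M}_{1,n}(\mathbf{S}^+),\mathcal{M}_{1,N-n}(\mathbf{S}^-)\backslash\{S_j^--S_{j-1}^-\},S_j^--S_{j-1}^-+1)/D$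 if $S_j^->S_{j-1}^-$, and $0$ otherwise. The function $a_f$. $$a_f(t|\mathbf{S}^-,\mathbf{S}^+,\theta,\mathbf{T})=\Big[\eta_0(\mathbf{S}^+,\mathbf{S}^-)d^+_{\theta,0}(t)+\sum_{j=1}^n\eta_j^+(\mathbf{S}^+,\mathbf{S}^-)d^+_{\theta,j}(t|\mathbf{S}^+)\Big]\mathbb{I}(t>\theta)+\Big[\eta_0(\mathbf{S}^+,\mathbf{S}^-)d^-_{\theta,0}(t)+\sum_{j=1}^{N-n}\eta_j^-(\mathbf{S}^+,\mathbf{S}^-)d^-_{\theta,j}(t|\mathbf{S}^-)\Big]\mathbb{I}(t<\theta),$$ with $d^+_{\theta,0}(t)=\int_{t-\theta}^\infty X^{-1}H(dX)$, $d^-_{\theta,0}(t)=\int_{-\infty}^{t-\theta}(-X)^{-1}H(dX)$, $$d^+_{\theta,j}(t|\mathbf{S}^+)=\frac{\int_{\max(t-\theta,Y_j)}^\infty U^{-(S_j^+-S_{j-1}^++1)}H(dU)}{\int_{Y_j}^\infty U^{-(S_j^+-S_{j-1}^+)}H(dU)}\ \text{ if }S_j^+>S_{j-1}^+\ (0\text{ otherwise}),\quad j=1,\dots,n,$$ $$d^-_{\theta,j}(t|\mathbf{S}^-)=\frac{\int_{-\infty}^{\min(t-\theta,Z_j)}(-V)^{-(S_j^--S_{j-1}^-+1)}H(dV)}{\int_{-\infty}^{Z_j}(-V)^{-(S_j^--S_{j-1}^-)}H(dV)}\ \text{ if }S_j^->S_{j-1}^-\ (0\text{ otherwise}),\quad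 j=1,\dots,N-n.$$ The posterior is the version given by Bayes' formula, for $\mathbf{T}$ of positive finite marginal density; a pair of paths for which some factor in $\phi^+_\theta\phi^-_\theta$ (including a denominator) vanishes contributes zero. *)

(* Defs.v *)
From HB Require Import structures.
From mathcomp Require Import all_boot all_order all_algebra.
From mathcomp Require Import all_classical all_reals all_analysis.

Set Implicit Arguments.
Unset Strict Implicit.
Unset Printing Implicit Defensive.

Import Order.TTheory GRing.Theory Num.Theory.
Import numFieldNormedType.Exports.

Local Open Scope classical_set_scope.
Local Open Scope ring_scope.

Section Independence.
Context d (Omega : measurableType d) (R : realType) (P : probability Omega R).

Definition indep_sigma (F1 F2 : set (set Omega)) : Prop :=
  forall A B, F1 A -> F2 B -> P (A `&` B) = (P A * P B)%E.

Definition sigma_family d' (S : measurableType d') (K : set nat)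
    (X : nat -> Omega -> S) : set (set Omega) :=
  <<s \bigcup_(k in K) preimage_set_system setT (X k) measurable >>.

Definition indep_RV d1 d2 (S1 : measurableType d1) (S2 : measurableType d2)
    (X : Omega -> S1) (Y : Omega -> S2) : Prop :=
  indep_sigma (preimage_set_system setT X measurable)
              (preimage_set_system setT Y measurable).

(* Taking I a singleton shows that each X k has law mu. *)
Definition iid_family d' (S : measurableType d') (K : set nat)
    (X : nat -> Omega -> S) (mu : probability S R) : Prop :=
  forall (I : seq nat) (B : nat -> set S), uniq I -> [set` I] `<=` K ->
    (forall k, measurable (B k)) ->
    P (\bigcap_(k in [set` I]) (X k @^-1` B k)) = (\prod_(k <- I) mu (B k))%E.

End Independence.

Section SpeciesSampling.
Context d (Omega : measurableType d) (R : realType) (P : probability Omega R).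
Local Notation measR := (measurableTypeR R).

(* The atoms are indexed by K, a finite or infinite set of naturals; W k and
   xi k are irrelevant for k outside K. *)
Record species_sampling (K : set nat) (W xi : nat -> {RV P >-> measR})
    (H : probability measR R) (G : {RV P >-> pprobability measR R}) : Prop := {
  ss_nonatomic : forall x : R, H [set x] = 0%E ;
  ss_weight : forall k w, K k -> 0 < (W k w : R) < 1 ;
  ss_total : forall w, (\esum_(k in K) (W k w : R)%:E <= 1)%E ;
  ss_iid : iid_family P K xi H ;
  ss_indep : indep_sigma P (sigma_family K W) (sigma_family K xi) ;
  ss_form : forall w (B : set measR), measurable B ->
    (G w : probability measR R) B =
      (\esum_(k in K) ((W k w : R)%:E * \d_(xi k w) B) +
       (1 - \esum_(k in K) (W k w : R)%:E) * H B)%E }.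

(* The left-hand side of eppf_joint is the probability that X_1 \in B_1, ...,
   X_N \in B_N for X_1, ..., X_N iid from G given G; the right-hand side is
   the mass of the same rectangle under the measure
     \sum_p chi(e_1, ..., e_N(p)) \prod_k H(dX*_k). *)
Record is_eppf (H : probability measR R) (G : {RV P >-> pprobability measR R})
    (chi : seq nat -> R) : Prop := {
  eppf_nil : chi [::] = 1 ;
  eppf_ge0 : forall e, all (leq 1) e -> 0 <= chi e ;
  eppf_sym : forall e e', all (leq 1) e -> perm_eq e e' -> chi e = chi e' ;
  eppf_joint : forall N (B : 'I_N -> set measR), (forall i, measurable (B i)) ->
    (\int[P]_w \prod_(i < N) (G w : probability measR R) (B i) =
     \sum_(p : {set {set 'I_N}} | finset.partition p [set: 'I_N]%SET)
       (chi [seq #|C| | C : {set 'I_N} <- enum p])%:E *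
       \prod_(C in p) H (\bigcap_(i in [set` C]) B i))%E }.

End SpeciesSampling.

Section Model.
Context (R : realType).
Local Notation measR := (measurableTypeR R).

Definition unimodal_density (mu : probability measR R) (th t : R) : R :=
  \int[mu]_x (x^-1 * (((0 < t - th) && (t - th <= x))%R%:R
                      - ((x <= t - th) && (t - th < 0))%R%:R)).

Context d (Omega : measurableType d) (P : probability Omega R).
Variables (G : {RV P >-> pprobability measR R}) (theta : {RV P >-> measR}).
Variables (N : nat) (T : 'I_N -> R).

Definition likelihood (w : Omega) : R :=
  \prod_(k < N) unimodal_density (G w) (theta w) (T k).

Definition marginal_density : \bar R := (\int[P]_w (likelihood w)%:E)%E.

(* Expectation of g under the posterior law of w given T, that is, the law
   with density likelihood / marginal_density with respect to P. *)
Definition posterior_mean (g : Omega -> R) : \bar R :=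
  (\int[P]_w (g w * likelihood w)%:E / marginal_density)%E.

End Model.

Section Paths.
Variable n : nat.

(* An S-path satisfies 0 <= S_j <= j <= n, so its coordinates fit in 'I_n.+1. *)
Definition Svec := {ffun 'I_n.+1 -> 'I_n.+1}.

Implicit Types (S : Svec) (j : 'I_n.+1).

(* S_(j-1) for j >= 1; for j = 0 this is S_0. *)
Definition Sprev S j : nat := S (inord j.-1).

(* In particular 0 is never a jump. *)
Definition jump S j : bool := (Sprev S j < S j)%N.

Definition incr S j : nat := (S j - Sprev S j)%N.

Definition is_Spath S : bool :=
  [&& S ord0 == ord0, S ord_max == ord_max &
      [forall j, (S j <= j)%N && (Sprev S j <= S j)%N]].

(* The set {1, ..., n} is the complement of ord0 in 'I_n.+1. *)
Definition cell_max (C : {set 'I_n.+1}) j : bool :=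
  (j \in C) && [forall i in C, (i <= j)%N].

Definition corresponds (p : {set {set 'I_n.+1}}) S : bool :=
  [&& finset.partition p (~: [set ord0])%SET,
      [forall j, jump S j == [exists C in p, cell_max C j]] &
      [forall C in p, forall j, cell_max C j ==> (#|C : {set 'I_n.+1}| == incr S j)]].

Definition Spartitions S : {set {set {set 'I_n.+1}}} :=
  [set p | corresponds p S]%SET.

Definition mults S : seq nat := [seq incr S j | j <- enum 'I_n.+1 & jump S j].

End Paths.

Section Posterior.
Context (R : realType).
Local Notation measR := (measurableTypeR R).
Variables (H prior : probability measR R) (chi : seq nat -> R).
Variables (N : nat) (T : 'I_N -> R).

Definition npos (th : R) : nat := #|[set k | th < T k]%SET|.

Definition hits (th : R) : bool := [exists k, T k == th].

(* Ydist th j and Zdist th j are Y_j and Z_j, with j counted from 1: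
   0 < Y_1 < Y_2 < ... and 0 > Z_1 > Z_2 > ... *)
Definition Ydist (th : R) (j : nat) : R :=
  nth 0 (sort <=%R [seq T k - th | k <- enum 'I_N & th < T k]) j.-1.

Definition Zdist (th : R) (j : nat) : R :=
  nth 0 (sort >=%R [seq T k - th | k <- enum 'I_N & T k < th]) j.-1.

Section FixedTheta.
Variable th : R.
Local Notation n := (npos th).
Local Notation n' := (N - npos th)%N.

Definition upper_moment (a : R) (m : nat) : R :=
  \int[H]_(u in `[a, +oo[) u ^- m.

Definition lower_moment (b : R) (m : nat) : R :=
  \int[H]_(v in `]-oo, b]) (- v) ^- m.

Variables (Sm : Svec n') (Sp : Svec n).

Definition phi_plus : R :=
  #|Spartitions Sp|%:R * chi (mults Sp) *
  \prod_(j < n.+1 | jump Sp j) upper_moment (Ydist th j) (incr Sp j).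

Definition phi_minus : R :=
  #|Spartitions Sm|%:R * (chi (mults Sp ++ mults Sm) / chi (mults Sp)) *
  \prod_(j < n'.+1 | jump Sm j) lower_moment (Zdist th j) (incr Sm j).

Definition eta0 : R :=
  chi (mults Sp ++ mults Sm ++ [:: 1%N]) / chi (mults Sp ++ mults Sm).

Definition eta_plus (j : 'I_n.+1) : R :=
  if jump Sp j then
    chi (rem (incr Sp j) (mults Sp) ++ mults Sm ++ [:: (incr Sp j).+1])
      / chi (mults Sp ++ mults Sm)
  else 0.

Definition eta_minus (j : 'I_n'.+1) : R :=
  if jump Sm j then
    chi (mults Sp ++ rem (incr Sm j) (mults Sm) ++ [:: (incr Sm j).+1])
      / chi (mults Sp ++ mults Sm)
  else 0.

Definition d_plus0 (t : R) : R := upper_moment (t - th) 1.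

Definition d_minus0 (t : R) : R := lower_moment (t - th) 1.

Definition d_plus (j : 'I_n.+1) (t : R) : R :=
  if jump Sp j then
    upper_moment (Num.max (t - th) (Ydist th j)) (incr Sp j).+1
      / upper_moment (Ydist th j) (incr Sp j)
  else 0.

Definition d_minus (j : 'I_n'.+1) (t : R) : R :=
  if jump Sm j then
    lower_moment (Num.min (t - th) (Zdist th j)) (incr Sm j).+1
      / lower_moment (Zdist th j) (incr Sm j)
  else 0.

(* The sums may start at j = 0, which is not a jump and contributes 0. *)
Definition a_f (t : R) : R :=
  (eta0 * d_plus0 t + \sum_(j < n.+1) eta_plus j * d_plus j t) * (th < t)%R%:R +
  (eta0 * d_minus0 t + \sum_(j < n'.+1) eta_minus j * d_minus j t) * (t < th)%R%:R.

(* As x / 0 = 0, this vanishes as soon as some factor of phi_plus or phi_minus,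
   or the denominator chi (mults Sp), does. *)
Definition path_weight : R := if hits th then 0 else phi_plus * phi_minus.

End FixedTheta.

Definition path_norm : \bar R :=
  (\int[prior]_th
     (\sum_(Sp : Svec (npos th) | is_Spath Sp)
      \sum_(Sm : Svec (N - npos th) | is_Spath Sm) path_weight Sm Sp)%R%:E)%E.

(* The density of pi(Sm, Sp, d th | T) with respect to the prior. *)
Definition path_posterior (th : R) (Sm : Svec (N - npos th)) (Sp : Svec (npos th)) :
  \bar R := ((path_weight Sm Sp)%:E / path_norm)%E.

End Posterior.

(* Main.v *)
Require Import Defs.
From mathcomp Require Import all_boot all_order all_algebra.
From mathcomp Require Import all_classical all_reals all_analysis.
From mathcomp Require Import measurable_realfun ring.

Set Implicit Arguments.
Unset Strict Implicit.
Unset Printing Implicit Defensive.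

Import Order.TTheory GRing.Theory Num.Theory.
Import numFieldNormedType.Exports.

(** The density [f(t|G,th)] is the mean under [G] of a kernel: for [t] above the
    mode [th] it is [x^-1] on the half-line [x >= t - th], and symmetrically
    below it.  The posterior mean is therefore a ratio of two expectations of
    products of means under [G], the numerator containing one more factor, that
    of [t].  As [G] and the mode are independent, both are integrals over the
    prior of the mode of an expectation over [G] alone ([integral_indep]).

    At a fixed mode, the exchangeable partition probability function gives the
    expectation of a product of means ([eppf_mean]): a sum over the partitions
    of the sample of [chi] at the cell sizes times, for each cell, the mean
    under [H] of the product of the kernels of its points.  A cell with points
    on both sides of the mode contributes zero since the supports are disjoint.
    A cell on one side contributes a moment of [H] on the half-line attached to
    its point farthest from the mode, hence a quantity that depends only on its
    maximum and on its size once the points of each side are numbered by their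
    distance to the mode.  An S-path records exactly these maxima and sizes, so
    the sum over partitions is a sum over pairs of paths, each pair counted with
    the number of its partitions ([sum_partition_paths]).  The total is the sum
    of the path weights, so the two normalising constants agree.

    For the numerator, [t] is a further point of the sample: it opens a new cell
    or joins one of the cells of the partition of the observations
    ([sum_partition_paths_add_point]).  Compared with the weight of the pair of
    paths, this multiplies it by the function [a_f] ([a_f_path_weight]).

    The divisions in [a_f] and in the path weights require that a numerator be
    zero whenever its denominator is.  For moments of [H] this is a domination.
    For [chi] it follows from the addition rule ([eppf_addition]): the value at
    a partition is the sum of the nonnegative values at its extensions by one
    point.  That rule is derived from the partition formula itself, by the
    linear independence of the products over cells ([partition_weights_eq0]),
    and this is where the absence of atoms of [H] is used, to find disjoint sets
    of positive mass ([nonatomic_disjoint]). *)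

Local Open Scope ring_scope.

(** * Sums over set partitions *)

Section SetPartitions.

Lemma big_bij (V : Type) (idx : V) (op : Monoid.com_law idx) (S T : finType)
    (P : pred S) (Q : pred T) (f : S -> T) (f' : T -> S) (F : T -> V) :
    (forall x, P x -> Q (f x) /\ f' (f x) = x) ->
    (forall y, Q y -> P (f' y) /\ f (f' y) = y) ->
  \big[op/idx]_(y | Q y) F y = \big[op/idx]_(x | P x) F (f x).
Proof.
move=> fP f'P; rewrite (reindex_onto f f') => [|y /f'P[]//].
apply: eq_bigl => x; apply/andP/idP => [[/f'P[Px _] /eqP <-]//|Px].
by have [-> ->] := fP x Px.
Qed.

Local Open Scope set_scope.

(** The defining boolean counts elements through a cover; reindexings of
    partitions are easier to check cell by cell. *)
Lemma partitionP (I : finType) (p : {set {set I}}) (A : {set I}) :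
  reflect [/\ {in p, forall C, C != finset.set0 /\ C \subset A},
              {in A, forall x, exists2 C, C \in p & x \in C} &
              forall C D x, C \in p -> D \in p -> x \in C -> x \in D -> C = D]
          (finset.partition p A).
Proof.
apply: (iffP idP) => [pA|[cell ex uniq]].
  split => [C Cp|x|C D x Cp Dp xC xD].
  - by rewrite (partition_neq0 pA)// (partitionS pA).
  - by rewrite -(cover_partition pA) => /finset.bigcupP[C ? ?]; exists C.
  - have tI := partition_trivIset pA.
    by rewrite -(def_pblock tI Cp xC) (def_pblock tI Dp xD).
apply/and3P; split.
- apply/eqP/setP => x; apply/finset.bigcupP/idP => [[C Cp xC]|/ex[C]]; last by exists C.
  by have [_ /fintype.subsetP] := cell _ Cp; apply.
- apply/finset.trivIsetP => C D Cp Dp; apply: contraNT => /pred0Pn[x /andP[/= xC xD]].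
  by apply/eqP/(uniq _ _ x).
- by apply/negP => /cell[]; rewrite eqxx.
Qed.

Lemma partition_imset (I J : finType) (h : I -> J) (A : {set I}) (p : {set {set I}}) :
  {in A &, injective h} -> finset.partition p A ->
  finset.partition [set h @: (C : {set I}) | C in p]%SET (h @: A)%SET.
Proof.
move=> hinj /partitionP[cell ex uniq].
have sub C : C \in p -> C \subset A by move=> /cell[].
apply/partitionP; split.
- move=> _ /imsetP[C Cp ->]; rewrite finset.imset_eq0 imsetS ?sub//.
  by have [] := cell _ Cp.
- move=> _ /imsetP[x xA ->]; have [C Cp xC] := ex _ xA.
  by exists (h @: C)%SET; rewrite imset_f.
- move=> _ _ y /imsetP[C Cp ->] /imsetP[D Dp ->] /imsetP[x xC ->] /imsetP[z zD].
  move=> /hinj e; suff -> : C = D by []; apply: (uniq _ _ x) => //.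
  have -> // : x = z.
  by apply: e; [exact: (fintype.subsetP (sub _ Cp)) | exact: (fintype.subsetP (sub _ Dp))].
Qed.

Lemma partition_setU (I : finType) (A B : {set I}) (p q : {set {set I}}) :
  [disjoint A & B] -> finset.partition p A -> finset.partition q B ->
  finset.partition (p :|: q)%SET (A :|: B)%SET.
Proof.
move=> dAB /partitionP[cellp exp uniqp] /partitionP[cellq exq uniqq].
have pd C x : C \in p -> x \in C -> x \in A.
  by move=> /cellp[_ /fintype.subsetP]; apply.
have qd C x : C \in q -> x \in C -> x \in B.
  by move=> /cellq[_ /fintype.subsetP]; apply.
apply/partitionP; split.
- move=> C; rewrite inE => /orP[/cellp|/cellq] [-> CS]; split => //.
    exact: fintype.subset_trans CS (finset.subsetUl _ _).
  exact: fintype.subset_trans CS (finset.subsetUr _ _).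
- move=> x; rewrite inE => /orP[/exp|/exq] [C Cp xC]; exists C => //.
    by rewrite inE Cp.
  by rewrite inE Cp orbT.
- move=> C D x; rewrite !inE => /orP[Cp|Cq] /orP[Dp|Dq] xC xD.
  + exact: uniqp xC xD.
  + by have := disjointFr dAB (pd _ _ Cp xC); rewrite (qd _ _ Dq xD).
  + by have := disjointFr dAB (pd _ _ Dp xD); rewrite (qd _ _ Cq xC).
  + exact: uniqq xC xD.
Qed.

Section Sums.
Context (V : nmodType).

Lemma sum_partition_imset (I J : finType) (h : I -> J) (A : {set I})
    (F : {set {set J}} -> V) : {in A &, injective h} ->
  (\sum_(q | finset.partition q (h @: A)%SET) F q =
   \sum_(p | finset.partition p A) F [set h @: (C : {set I}) | C in p]%SET)%R.
Proof.
(* Intersecting with [A] matters: [h] is injective on [A] only. *)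
move=> hinj; pose f' (q : {set {set J}}) := [set A :&: h @^-1: (D : {set J}) | D in q]%SET.
have hK (C : {set I}) : C \subset A -> A :&: h @^-1: (h @: C) = C.
  move=> CA; apply/setP => x; rewrite !inE; apply/andP/idP => [[xA]|xC].
    by case/imsetP => y yC /hinj -> //; apply: (fintype.subsetP CA).
  by rewrite (fintype.subsetP CA)// imset_f.
have hK' (D : {set J}) : D \subset h @: A -> h @: (A :&: h @^-1: D) = D.
  move=> DA; apply/setP => y; apply/imsetP/idP => [[x]|yD].
    by rewrite !inE => /andP[_ ?] ->.
  by have /imsetP[x xA e] := fintype.subsetP DA _ yD; exists x; rewrite // !inE xA -e.
apply: (@big_bij _ _ _ _ _ _ _ _ f') => [p pA|q /partitionP[cell ex uniq]].
- split; first exact: partition_imset.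
  rewrite /f' -imset_comp -[RHS]imset_id; apply: eq_in_imset => C Cp /=.
  by rewrite hK// (partitionS pA).
- have sub D : D \in q -> D \subset h @: A by move=> /cell[].
  split; last first.
    rewrite /f' -imset_comp -[RHS]imset_id; apply: eq_in_imset => C Cp /=.
    by rewrite hK'// sub.
  apply/partitionP; split.
  + move=> _ /imsetP[D Dq ->]; rewrite finset.subsetIl; split=> //.
    by rewrite -(finset.imset_eq0 h) hK' ?sub//; have [] := cell _ Dq.
  + move=> x xA; have [D Dq xD] := ex _ (imset_f h xA).
    exists (A :&: h @^-1: D); last by rewrite !inE xA.
    by apply/imsetP; exists D.
  + move=> _ _ y /imsetP[C Cp ->] /imsetP[D Dp ->].
    rewrite !inE => /andP[_ yC] /andP[_ yD].
    by rewrite (uniq C D (h y)).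
Qed.

(** Once the partitions with a mixed cell are discarded, a partition of the
    union is determined by its restrictions to the two halves, which can be
    chosen freely. *)
Lemma sum_partition_split (I : finType) (A B : {set I})
    (F : {set {set I}} -> V) : [disjoint A & B] ->
    (forall p, finset.partition p (A :|: B)%SET ->
       (exists2 C : {set I}, C \in p & ~~ (C \subset A) && ~~ (C \subset B)) -> F p = 0%R) ->
  (\sum_(p | finset.partition p (A :|: B)%SET) F p =
   \sum_(p | finset.partition p A) \sum_(q | finset.partition q B) F (p :|: q)%SET)%R.
Proof.
move=> dAB F0; rewrite (bigID (fun p : {set {set I}} =>
  [forall C in p, (C \subset A) || (C \subset B)])) /= [X in (_ + X)%R]big1 ?addr0; last first.
  move=> p /andP[pAB]; rewrite negb_forall => /existsP[C].
  rewrite negb_imply negb_or => /andP[Cp CAB].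
  by apply: F0 => //; exists C.
rewrite pair_big /=.
have nAB (C : {set I}) : C != finset.set0 -> C \subset A -> C \subset B = false.
  case/set0Pn => x xC CA; apply/negP => CB.
  have := disjointFr dAB (fintype.subsetP CA _ xC).
  by rewrite (fintype.subsetP CB).
have nBA (C : {set I}) : C != finset.set0 -> C \subset B -> C \subset A = false.
  by move=> C0; apply: contraTF => /nAB ->.
apply: (@big_bij _ _ _ _ _ (fun pq : {set {set I}} * {set {set I}} =>
    finset.partition pq.1 A && finset.partition pq.2 B) _
    (fun pq => pq.1 :|: pq.2)
    (fun p => ([set C : {set I} in p | C \subset A]%SET,
               [set C : {set I} in p | C \subset B]%SET))).
- move=> [p q] /= /andP[pA qB].
  have [cellp _ _] := partitionP _ _ pA; have [cellq _ _] := partitionP _ _ qB.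
  split; first (apply/andP; split); first exact: partition_setU.
  + apply/forallP => C; apply/implyP; rewrite inE => /orP[/cellp|/cellq] [_ ->] //.
    by rewrite orbT.
  + congr pair; apply/setP => C; rewrite !inE.
      apply/andP/idP => [[/orP[//|/cellq[C0 CB]]]|Cp].
        by rewrite nBA.
      by rewrite Cp; have [_ ->] := cellp _ Cp.
    apply/andP/idP => [[/orP[/cellp[C0 CB]|//]]|Cp].
      by rewrite nAB.
    by rewrite Cp orbT; have [_ ->] := cellq _ Cp.
- move=> p /andP[/partitionP[cell ex uniq] /forallP cAB] /=.
  split; last first.
    apply/setP => C; rewrite !inE -andb_orr.
    by apply/andP/idP => [[]//|Cp]; split=> //; apply: (implyP (cAB C)).
  apply/andP; split; apply/partitionP; split.
  + by move=> C; rewrite inE => /andP[/cell[]].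
  + move=> x xA; have [|C Cp xC] := ex x; first by rewrite inE xA.
    exists C => //; rewrite inE Cp /=; have /orP[//|CB] := implyP (cAB C) Cp.
    by have := disjointFr dAB xA; rewrite (fintype.subsetP CB).
  + by move=> C D x; rewrite !inE => /andP[? _] /andP[? _]; apply: uniq.
  + by move=> C; rewrite inE => /andP[/cell[]].
  + move=> x xA; have [|C Cp xC] := ex x; first by rewrite inE xA orbT.
    exists C => //; rewrite inE Cp /=; have /orP[CB|//] := implyP (cAB C) Cp.
    by have := disjointFl dAB xA; rewrite (fintype.subsetP CB).
  + by move=> C D x; rewrite !inE => /andP[? _] /andP[? _]; apply: uniq.
Qed.

(** A new point either opens a cell of its own or joins one of the existing
    cells; removing it recovers the original partition and the choice made. *)
Lemma sum_partition_add_point (I : finType) (x : I) (A : {set I})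
    (F : {set {set I}} -> V) : x \notin A ->
  (\sum_(q | finset.partition q (x |: A)%SET) F q =
   \sum_(p | finset.partition p A)
     (F ([set x] |: p)%SET + \sum_(C in p) F ((x |: C) |: (p :\ C))%SET))%R.
Proof.
move=> xA; rewrite big_split /= (bigID (fun q : {set {set I}} => [set x]%SET \in q)) /=.
have cellA (p : {set {set I}}) C : finset.partition p A -> C \in p ->
    x \notin C /\ exists2 y, y \in C & y \in A.
  move=> /partitionP[cell _ _] /cell[/set0Pn[y yC] /fintype.subsetP CA]; split.
    by apply: contra xA => /CA.
  by exists y => //; apply: CA.
congr (_ + _)%R.
  apply: (@big_bij _ _ _ _ _ _ _ (fun p => [set x] |: p)
            (fun q => q :\ [set x]%SET)).
  - move=> p pA; split; last first.
      rewrite finset.setU1K//; apply/negP => /(cellA _ _ pA)[].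
      by rewrite inE eqxx.
    rewrite setU11 andbT partitionU1//; first by apply/set0Pn; exists x; rewrite inE.
    by rewrite finset.disjoints_subset finset.sub1set inE.
  - move=> q /andP[qA xq]; split; last by rewrite finset.setD1K.
    have := partitionD1 qA xq.
    rewrite (_ : (x |: A) :\: [set x]%SET = A)//.
    by rewrite finset.setU1K.
rewrite pair_big_dep /=.
pose f (pC : {set {set I}} * {set I}) := (x |: pC.2) |: (pC.1 :\ pC.2).
pose f' (q : {set {set I}}) := ((finset.pblock q x :\ x) |: (q :\ finset.pblock q x), finset.pblock q x :\ x).
apply: (big_bij _ (f := f) (f' := f')) => [[p C]|q]; rewrite /f /f' /=.
- move=> /andP[pA Cp].
  have qA : finset.partition ((x |: C) |: (p :\ C)) (x |: A).
    have -> : x |: A = (x |: C) :|: (A :\: C).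
      apply/setP => y; rewrite !inE; have := fintype.subsetP (partitionS pA Cp) y.
      by case: (y \in C) => //= [->|_]; rewrite ?orbT ?orbF.
    apply: partitionU1; first exact: partitionD1.
      by apply/set0Pn; exists x; rewrite setU11.
    rewrite -setI_eq0; apply/eqP/setP => y; rewrite !inE.
    by case: eqP => [->|_]; rewrite ?(negbTE xA) ?andbF//=; case: (y \in C).
  have xb : finset.pblock ((x |: C) |: (p :\ C)) x = x |: C.
    apply: def_pblock; last exact: setU11; last exact: setU11.
    exact: partition_trivIset qA.
  have [xC [y yC yA]] := cellA _ _ pA Cp.
  rewrite qA xb finset.setU1K//; split.
    apply/negP; rewrite !inE => /orP[/eqP e|/andP[_ /(cellA _ _ pA)[]]].
      have : y \in x |: C by rewrite !inE yC orbT.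
      by rewrite -e inE => /eqP yx; rewrite yx (negbTE xA) in yA.
    by rewrite inE eqxx.
  congr pair; rewrite finset.setU1K ?finset.setD1K// !inE.
  apply/negP => /andP[_ /(cellA _ _ pA)[]].
  by rewrite !inE eqxx.
- move=> /andP[qA xq].
  have tq := partition_trivIset qA.
  have xcov : x \in finset.cover q by rewrite (cover_partition qA) setU11.
  have bq : finset.pblock q x \in q by rewrite pblock_mem.
  have xb : x \in finset.pblock q x by rewrite mem_pblock.
  have bx : finset.pblock q x :\ x != finset.set0.
    apply: contra xq => /eqP e.
    by rewrite -(finset.setU0 [set x]%SET) -e finset.setD1K.
  have bn : finset.pblock q x :\ x \notin q :\ finset.pblock q x.
    apply/negP; rewrite inE => /andP[ne bq'].
    move/set0Pn: bx => [y yb]; have := def_pblock tq bq' yb.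
    move: yb; rewrite inE => /andP[_ yb]; rewrite (def_pblock tq bq yb) => e.
    by move: ne; rewrite inE -e eqxx.
  split; last by rewrite finset.setU1K// !finset.setD1K.
  rewrite setU11 andbT.
  have -> : A = (finset.pblock q x :\ x) :|: (A :\: finset.pblock q x).
    apply/setP => y; rewrite !inE; have := fintype.subsetP (partitionS qA bq) y.
    rewrite !inE; case: (y \in finset.pblock q x) => /=; rewrite ?andbT ?andbF ?orbF//.
    by move=> /(_ isT); case: eqP => //= -> _; apply/negbTE.
  apply: partitionU1 => //.
    rewrite [X in finset.partition _ X](_ : _ = (x |: A) :\: finset.pblock q x).
      exact: partitionD1.
    apply/setP => y; rewrite !inE.
    by case: eqP => [->|//]; rewrite xb.
  rewrite -setI_eq0; apply/eqP/setP => y; rewrite !inE.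
  by case: (y \in finset.pblock q x); rewrite ?andbF.
Qed.

End Sums.

End SetPartitions.

(** * Partitions and S-paths *)

Section SPaths.
Context (n : nat).
Implicit Types (p : {set {set 'I_n.+1}}) (C : {set 'I_n.+1}) (j : 'I_n.+1) (S : Svec n).

Local Notation N1 := (~: [set ord0 : 'I_n.+1])%SET.

Lemma val_pred j : (inord j.-1 : 'I_n.+1) = j.-1 :> nat.
Proof. by rewrite inordK// (leq_ltn_trans (leq_pred _)). Qed.

Lemma cell_max_uniq C i j : cell_max C i -> cell_max C j -> i = j.
Proof.
move=> /andP[iC /forallP iM] /andP[jC /forallP jM]; apply/val_inj/eqP.
by rewrite eqn_leq (implyP (jM i))// (implyP (iM j)).
Qed.

Lemma cell_max_ex C : C != finset.set0 -> exists j, cell_max C j.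
Proof.
move=> /set0Pn[i iC]; exists [arg max_(j > i in C) j]%N.
case: arg_maxnP => //= j jC jM; apply/andP; split=> //.
by apply/forallP => k; apply/implyP => /jM.
Qed.

(** The default [ord0] is returned on the empty set only, which is never a
    cell of a partition. *)
Definition cmax C : 'I_n.+1 := odflt ord0 [pick j | cell_max C j].

Lemma cmaxP C : C != finset.set0 -> cell_max C (cmax C).
Proof.
move=> /cell_max_ex[j jC]; rewrite /cmax; case: pickP => //= /(_ j).
by rewrite jC.
Qed.

(** The elements whose cell is complete at time [k], all its members being at
    most [k].  Their number is the coordinate [S_k] of the path. *)
Definition done_by p (k : nat) : {set 'I_n.+1} :=
  [set i in N1 | [forall i' in finset.pblock p i, (i' <= k)%N]]%SET.

Definition path_of p : Svec n := [ffun j => inord #|done_by p (j : 'I_n.+1)|].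

Lemma card_done_by p k : finset.partition p N1 -> (k <= n)%N ->
  (#|done_by p k| <= k)%N.
Proof.
move=> pN kn.
have : done_by p k \subset [set i in N1 | (i <= k)%N]%SET.
  apply/fintype.subsetP => i; rewrite !inE => /andP[i0 /forallP iM]; rewrite i0 /=.
  by apply: (implyP (iM i)); rewrite mem_pblock (cover_partition pN) !inE.
move/subset_leq_card/leq_trans; apply.
rewrite -[leqRHS]card_ord.
pose f (i : 'I_k) : 'I_n.+1 := inord i.+1.
have fE (i : 'I_k) : f i = i.+1 :> nat by rewrite inordK// ltnS (leq_trans _ kn).
have finj : injective f.
  by move=> i j e; apply/ord_inj/eq_add_S; rewrite -!fE e.
rewrite -(card_imset _ finj).
apply/subset_leq_card/fintype.subsetP => i; rewrite !inE => /andP[i0 ik].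
have i0' : (0 < i)%N by rewrite lt0n; apply: contra i0 => /eqP i0; apply/eqP/val_inj.
have hi : (i.-1 < k)%N by rewrite prednK.
apply/imsetP; exists (Ordinal hi) => //; apply/val_inj => /=.
by rewrite /f /= prednK// inordK.
Qed.

Lemma path_ofE p j : finset.partition p N1 -> path_of p j = #|done_by p j| :> nat.
Proof.
move=> pN; rewrite ffunE inordK// ltnS.
by apply: (leq_trans (card_done_by pN _)); rewrite -ltnS.
Qed.

Lemma done_by_le p k l : (k <= l)%N -> done_by p k \subset done_by p l.
Proof.
move=> kl; apply/fintype.subsetP => i; rewrite !inE => /andP[-> /forallP iM] /=.
by apply/forallP => i'; apply/implyP => /(implyP (iM i'))/leq_trans; apply.
Qed.

Lemma is_Spath_path_of p : finset.partition p N1 -> is_Spath (path_of p).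
Proof.
move=> pN; apply/and3P; split.
- apply/eqP/val_inj => /=; rewrite path_ofE//; apply/eqP.
  by rewrite -leqn0 card_done_by.
- apply/eqP/val_inj => /=; rewrite path_ofE//.
  transitivity #|N1|; last by rewrite finset.cardsC1 card_ord.
  apply/eq_card => i; rewrite !inE -[RHS]andbT; congr andb.
  by apply/forallP => i'; apply/implyP => _; rewrite -ltnS.
- apply/forallP => j; rewrite /Sprev !path_ofE// card_done_by//; last by rewrite -ltnS.
  by rewrite subset_leq_card// done_by_le// val_pred leq_pred.
Qed.

Lemma mem_cell p i : finset.partition p N1 -> i \in N1 ->
  finset.pblock p i \in p /\ i \in finset.pblock p i.
Proof.
move=> pN iN; have ic : i \in finset.cover p by rewrite (cover_partition pN).
by rewrite pblock_mem// mem_pblock.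
Qed.

(** At time [j] exactly the cell with maximum [j] is completed, if there is
    one; so the path jumps at the maxima, by the size of the completed cell. *)
Lemma done_byD p j : finset.partition p N1 ->
  (done_by p j :\: done_by p j.-1 =
   [set i in N1 | cell_max (finset.pblock p i) j])%SET.
Proof.
move=> pN; apply/setP => i; rewrite !inE.
have [->|i0 /=] := eqVneq i ord0; rewrite /= ?andbF//.
have iN : i \in N1 by rewrite !inE.
have [bp ib] := mem_cell pN iN.
have := bp; set B := finset.pblock p i => Bp.
rewrite /cell_max -/B; apply/andP/andP => -[].
  move=> /forallPn[k]; rewrite negb_imply -ltnNge => /andP[kB kj] jM; split => //.
  suff -> : j = k by [].
  apply/val_inj/eqP; rewrite eqn_leq (implyP (forallP jM k))// andbT.
  by rewrite (leq_trans _ kj)// leqSpred.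
move=> jB jM; split => //; apply/forallPn; exists j; rewrite negb_imply jB -ltnNge.
case: (posnP j) => [j0|j0]; last by rewrite prednK//= leqnn.
have : j \in N1 by apply: (fintype.subsetP (partitionS pN Bp)).
by rewrite !inE => /negP; case; apply/eqP/val_inj.
Qed.

Lemma path_of_incr p j : finset.partition p N1 ->
  incr (path_of p) j = #|[set i in N1 | cell_max (finset.pblock p i) j]%SET|.
Proof.
move=> pN; rewrite /incr /Sprev !path_ofE// val_pred -done_byD// finset.cardsD.
by rewrite (finset.setIidPr (done_by_le _ (leq_pred _))).
Qed.

Lemma cell_max_block p C j : finset.partition p N1 -> C \in p -> cell_max C j ->
  [set i in N1 | cell_max (finset.pblock p i) j]%SET = C.
Proof.
move=> pN Cp Cj; apply/setP => i; rewrite inE; apply/andP/idP => [[iN /andP[jb _]]|iC].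
  have [bp ib] := mem_cell pN iN.
  have /andP[jC _] := Cj; have tI := partition_trivIset pN.
  by rewrite -(def_pblock tI Cp jC) (def_pblock tI bp jb).
rewrite (def_pblock (partition_trivIset pN) Cp iC); split=> //.
exact: (fintype.subsetP (partitionS pN Cp)).
Qed.

Lemma corresponds_path_of p : finset.partition p N1 -> corresponds p (path_of p).
Proof.
move=> pN; apply/and3P; split=> //.
- apply/forallP => j; apply/eqP; rewrite /jump -subn_gt0 -/(incr _ _) path_of_incr//.
  apply/card_gt0P/existsP => [[i]|[C /andP[Cp Cj]]].
    rewrite inE => /andP[iN bj]; exists (finset.pblock p i); rewrite bj andbT.
    by case: (mem_cell pN iN).
  rewrite (cell_max_block pN Cp Cj).
  by have /set0Pn[i iC] := partition_neq0 pN Cp; exists i.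
- apply/forallP => C; apply/implyP => Cp; apply/forallP => j; apply/implyP => Cj.
  by rewrite path_of_incr// (cell_max_block pN Cp Cj).
Qed.

Lemma corresponds_jump p S C : corresponds p S -> C \in p ->
  jump S (cmax C) /\ incr S (cmax C) = #|C|.
Proof.
move=> /and3P[pN /forallP pj /forallP pi] Cp.
have Cm := cmaxP (partition_neq0 pN Cp).
rewrite (eqP (pj _)); split; first by apply/existsP; exists C; rewrite Cp.
by have /forallP/(_ (cmax C)) := implyP (pi C) Cp; rewrite Cm => /eqP.
Qed.

(** Increments are truncated differences; they determine the path because an
    S-path is nondecreasing. *)
Lemma Spath_eq S S' : is_Spath S -> is_Spath S' ->
  (forall j, (S j - Sprev S j = S' j - Sprev S' j)%N) -> S = S'.
Proof.
move=> /and3P[/eqP S0 _ /forallP SM] /and3P[/eqP S0' _ /forallP SM'] e.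
apply/ffunP => -[k]; elim: k => [|k IH] hk.
  by rewrite (_ : Ordinal hk = ord0) ?S0 ?S0'//; apply/val_inj.
apply/val_inj => /=; set j := Ordinal hk.
have pj : inord j.-1 = Ordinal (ltnW hk) :> 'I_n.+1.
  by apply/ord_inj; rewrite (val_pred j).
have /andP[_ h] := SM j; have /andP[_ h'] := SM' j.
rewrite -(subnK h) -(subnK h') e; congr addn.
by rewrite /Sprev pj IH.
Qed.

Lemma corresponds_uniq p S S' : is_Spath S -> is_Spath S' ->
  corresponds p S -> corresponds p S' -> S = S'.
Proof.
move=> SP SP' pS pS'; apply: Spath_eq => // j.
have := pS => /and3P[pN /forallP /(_ j)/eqP pj _].
have := pS' => /and3P[_ /forallP /(_ j)/eqP pj' _].
have [/existsP[C /andP[Cp Cj]]|nC] := boolP [exists C in p, cell_max C j].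
  have -> : j = cmax C by apply: (cell_max_uniq Cj); apply/cmaxP/(partition_neq0 pN).
  have [_] := corresponds_jump pS Cp; rewrite /incr => ->.
  by have [_] := corresponds_jump pS' Cp; rewrite /incr => ->.
move: pj pj'; rewrite (negbTE nC) /jump => /negbT; rewrite -leqNgt => h /negbT.
by rewrite -leqNgt => h'; move: h h'; rewrite -!subn_eq0 => /eqP -> /eqP ->.
Qed.

(** Every partition corresponds to one and only one S-path, so the classes
    attached to the S-paths exhaust the partitions without overlap. *)
Lemma sum_partition_Spath (V : nmodType) (F : {set {set 'I_n.+1}} -> V) :
  \sum_(p | finset.partition p N1) F p =
  \sum_(S | is_Spath S) \sum_(p in Spartitions S) F p.
Proof.
rewrite (partition_big path_of (@is_Spath n)) => [|p]; last exact: is_Spath_path_of.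
apply: eq_bigr => S SP; apply: eq_bigl => p; rewrite inE.
apply/andP/idP => [[pN /eqP <-]|pS]; first exact: corresponds_path_of.
have pN : finset.partition p N1 by case/and3P: pS.
split=> //; apply/eqP/(corresponds_uniq (is_Spath_path_of pN) SP _ pS).
exact: corresponds_path_of.
Qed.

Lemma corresponds_block p S j : corresponds p S -> jump S j ->
  exists2 C, C \in p & cmax C = j.
Proof.
move=> /and3P[pN /forallP pj _]; rewrite (eqP (pj j)) => /existsP[C /andP[Cp Cj]].
exists C => //; apply: (cell_max_uniq _ Cj); apply/cmaxP/(partition_neq0 pN Cp).
Qed.

Lemma corresponds_inj p S : corresponds p S -> {in p &, injective cmax}.
Proof.
move=> /and3P[pN _ _] C D Cp Dp e.
have /andP[C1 _] := cmaxP (partition_neq0 pN Cp).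
have /andP[D1 _] := cmaxP (partition_neq0 pN Dp).
have tI := partition_trivIset pN.
by rewrite -(def_pblock tI Cp C1) e (def_pblock tI Dp D1).
Qed.

(** Taking the maximum is a bijection from the cells to the jumps of the path. *)
Lemma big_corresponds (V : Type) (idx : V) (op : Monoid.com_law idx) p S
    (F : 'I_n.+1 -> V) : corresponds p S ->
  \big[op/idx]_(j | jump S j) F j = \big[op/idx]_(C in p) F (cmax C).
Proof.
move=> pS; have -> : \big[op/idx]_(C in p) F (cmax C) = \big[op/idx]_(j in cmax @: p) F j.
  by rewrite big_imset//; exact: (corresponds_inj pS).
apply: eq_bigl => j; apply/idP/imsetP => [/(corresponds_block pS)[C ? <-]|[C Cp ->]].
  by exists C.
by case: (corresponds_jump pS Cp).
Qed.

Lemma perm_mults p S : corresponds p S ->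
  perm_eq [seq #|C| | C : {set 'I_n.+1} <- enum p] (mults S).
Proof.
move=> pS; apply: (@perm_trans _ [seq incr S (cmax C) | C <- enum p]).
  rewrite (_ : map _ _ = [seq incr S (cmax C) | C <- enum p])//.
  apply/eq_in_map => C; rewrite mem_enum => Cp.
  by case: (corresponds_jump pS Cp).
rewrite /mults (map_comp (incr S) cmax); apply: perm_map.
apply: uniq_perm; [|exact/filter_uniq/enum_uniq|].
  rewrite map_inj_in_uniq ?enum_uniq// => C D; rewrite !mem_enum.
  exact: (corresponds_inj pS).
move=> j; rewrite mem_filter mem_enum andbT; apply/mapP/idP => [[C]|].
  by rewrite mem_enum => Cp ->; case: (corresponds_jump pS Cp).
by move=> /(corresponds_block pS)[C Cp <-]; exists C; rewrite ?mem_enum.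
Qed.

End SPaths.

(** * Cell sizes *)

(** The order of the list is that of an arbitrary enumeration: only symmetric
    functions of it are meaningful. *)
Definition sizes (I : finType) (p : {set {set I}}) : seq nat :=
  [seq #|C| | C : {set I} <- enum p].

Lemma perm_rem (T : eqType) (x : T) (s t : seq T) :
  x \in s -> perm_eq s t -> perm_eq (rem x s) (rem x t).
Proof.
move=> xs st; rewrite -(perm_cons x).
have xt : x \in t by rewrite -(perm_mem st).
by rewrite -(permPl (perm_to_rem xs)) (permPr (perm_to_rem xt)) in st *.
Qed.

Section Sizes.
Context (I : finType).
Implicit Types (p q : {set {set I}}) (C : {set I}).

Lemma sizesU1 p C : C \notin p -> perm_eq (sizes (C |: p)%SET) (#|C| :: sizes p).
Proof.
move=> Cp; rewrite /sizes -[#|C| :: _]/(map (fun D : {set I} => #|D|) (C :: enum p)).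
apply/perm_map/uniq_perm; rewrite ?enum_uniq//=; first by rewrite mem_enum Cp enum_uniq.
by move=> D; rewrite mem_enum !inE mem_enum.
Qed.

Lemma sizesD1 p C : C \in p -> perm_eq (sizes (p :\ C)%SET) (rem #|C| (sizes p)).
Proof.
move=> Cp; rewrite -(perm_cons #|C|).
have Cs : #|C| \in sizes p by apply/mapP; exists C; rewrite ?mem_enum.
apply: (perm_trans _ (perm_to_rem Cs)); rewrite perm_sym.
have /sizesU1 : C \notin (p :\ C)%SET by rewrite !finset.inE eqxx.
by rewrite finset.setD1K.
Qed.

Lemma sizesU p q : [disjoint p & q] -> perm_eq (sizes (p :|: q)%SET) (sizes p ++ sizes q).
Proof.
move=> pq; rewrite /sizes -map_cat; apply/perm_map/uniq_perm; rewrite ?enum_uniq//.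
  rewrite cat_uniq !enum_uniq /= andbT; apply/hasPn => C; rewrite !mem_enum => Cq.
  by rewrite (disjointFl pq).
by move=> C; rewrite mem_cat !mem_enum finset.inE.
Qed.

Lemma imset_cell_inj (J : finType) (h : J -> I) (p : {set {set J}}) (A : {set J}) :
  finset.partition p A -> {in A &, injective h} ->
  {in p &, injective (fun C : {set J} => h @: C)%SET}.
Proof.
move=> pA hA C D Cp Dp /= e; have /finset.set0Pn[x xC] := partition_neq0 pA Cp.
have : h x \in (h @: D)%SET by rewrite -e imset_f.
move=> /imsetP[y yD exy].
have xy : x = y.
  apply: hA => //.
    exact: (fintype.subsetP (partitionS pA Cp)).
  exact: (fintype.subsetP (partitionS pA Dp)).
rewrite -xy in yD; have tI := partition_trivIset pA.
by rewrite -(def_pblock tI Cp xC) (def_pblock tI Dp yD).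
Qed.

Lemma card_imset_cell (J : finType) (h : J -> I) (p : {set {set J}}) (A C : {set J}) :
  finset.partition p A -> {in A &, injective h} -> C \in p -> #|(h @: C)%SET| = #|C|.
Proof.
move=> pA hA Cp; apply: card_in_imset => x y xC yC; apply: hA.
  exact: (fintype.subsetP (partitionS pA Cp)).
exact: (fintype.subsetP (partitionS pA Cp)).
Qed.

Lemma sizes_imset (J : finType) (h : J -> I) (p : {set {set J}}) (A : {set J}) :
  finset.partition p A -> {in A &, injective h} ->
  perm_eq (sizes [set h @: (C : {set J}) | C in p]%SET) (sizes p).
Proof.
move=> pA hA; have hp := imset_cell_inj pA hA.
apply: (@perm_trans _ [seq #|(h @: C)%SET| | C : {set J} <- enum p]).
  rewrite /sizes (map_comp (fun D : {set I} => #|D|) (fun C : {set J} => (h @: C)%SET)).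
  apply/perm_map/uniq_perm; rewrite ?enum_uniq//.
    rewrite map_inj_in_uniq ?enum_uniq// => C D; rewrite !mem_enum; exact: hp.
  move=> D; rewrite mem_enum; apply/imsetP/mapP => -[C Cp ->]; exists C => //.
    by rewrite mem_enum.
  by rewrite mem_enum in Cp.
rewrite (_ : map _ _ = sizes p)//; apply/eq_in_map => C; rewrite mem_enum => Cp.
exact: card_imset_cell pA hA Cp.
Qed.

Lemma sizes_gt0 p (A : {set I}) :
  finset.partition p A -> all (leq 1) (sizes p).
Proof.
move=> pA; apply/allP => _ /mapP[C + ->]; rewrite mem_enum => Cp.
by rewrite card_gt0 (partition_neq0 pA).
Qed.

End Sizes.

Section Realization.
Context (e : seq nat).
Let J : finType := {i : 'I_(size e) & 'I_(nth 0%N e i)}.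
Let tg (i : 'I_(size e)) (j : 'I_(nth 0%N e i)) : J :=
  Tagged (fun i : 'I_(size e) => 'I_(nth 0%N e i)) j.
Let cell (i : 'I_(size e)) : {set option J} :=
  [set Some (tg j) | j : 'I_(nth 0%N e i)]%SET.

Let mem_cell i (v : J) : (Some v \in cell i) = (tag v == i).
Proof.
apply/imsetP/eqP => [[j _ [->]]//|]; case: v => k j /= ki.
by subst k; exists j.
Qed.

(** Turns identities between values of a symmetric function at partitions into
    identities at arbitrary lists.  The spare point [x] makes it possible to
    enlarge the partition. *)
Lemma sizes_surj : all (leq 1) e -> exists (I : finType) (x : I) (A : {set I}) p,
  [/\ x \notin A, finset.partition p A & perm_eq (sizes p) e].
Proof.
move=> e1; exists (option J), None, [set~ None]%SET, (cell @: [set: 'I_(size e)])%SET.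
have cN i : None \notin cell i by apply/imsetP => -[].
have e0 (i : 'I_(size e)) : (0 < nth 0%N e i)%N by apply: (allP e1); rewrite mem_nth.
have cell0 i : cell i != finset.set0.
  by apply/finset.set0Pn; exists (Some (tg (Ordinal (e0 i)))); rewrite mem_cell.
have cinj : injective cell.
  move=> i k eik; have : Some (Tagged _ (Ordinal (e0 i)) : J) \in cell k.
    by rewrite -eik mem_cell.
  by rewrite mem_cell => /eqP.
have ccard i : #|cell i| = nth 0%N e i.
  rewrite card_imset ?card_ord// => j k [] /eqP.
  by rewrite eq_Tagged => /eqP.
split; first by rewrite !finset.inE.
- apply/partitionP; split.
  + move=> _ /imsetP[i _ ->]; split=> //.
    apply/fintype.subsetP => -[v|]; first by rewrite !finset.inE.
    by rewrite (negbTE (cN i)).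
  + case=> [v _|]; last by rewrite !finset.inE.
    by exists (cell (tag v)); [apply/imsetP; exists (tag v); rewrite ?finset.inE|rewrite mem_cell].
  + move=> _ _ [v|] /imsetP[i _ ->] /imsetP[k _ ->]; last by rewrite (negbTE (cN i)).
    by rewrite !mem_cell => /eqP -> /eqP ->.
- apply: (@perm_trans _ [seq #|cell i| | i <- enum 'I_(size e)]).
    rewrite /sizes (map_comp (fun C : {set option J} => #|C|) cell).
    apply/perm_map/uniq_perm; [exact: enum_uniq|rewrite (map_inj_uniq cinj); exact: enum_uniq|].
    move=> C; rewrite mem_enum; apply/imsetP/mapP => -[i _ ->]; exists i => //; rewrite ?finset.inE//.
    by rewrite mem_enum.
  rewrite (eq_map ccard) -[X in perm_eq _ X](mkseq_nth 0%N) /mkseq -val_enum_ord.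
  by rewrite -map_comp.
Qed.

End Realization.

(** * Partitions of a two-sided sample *)

Section BigSides.
Context (V : Type) (idx : V) (op : Monoid.com_law idx).

Lemma big_setU_disjoint (I : finType) (A B : {set I}) (F : I -> V) : [disjoint A & B] ->
  \big[op/idx]_(i in (A :|: B)%SET) F i =
  op (\big[op/idx]_(i in A) F i) (\big[op/idx]_(i in B) F i).
Proof.
by move=> dAB; rewrite -bigU//; apply: eq_bigl => i; rewrite finset.inE.
Qed.

Context (J : finType) (n : nat) (h : 'I_n.+1 -> J).
Local Notation N1 := (~: [set ord0 : 'I_n.+1])%SET.
Hypothesis hinj : {in N1 &, injective h}.

Lemma big_side p (S : Svec n) (F : {set J} -> V) (f : 'I_n.+1 -> V) : corresponds p S ->
  (forall C, C \in p -> F (h @: C)%SET = f (cmax C)) ->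
  \big[op/idx]_(D in [set h @: (C : {set 'I_n.+1}) | C in p]%SET) F D =
  \big[op/idx]_(j | jump S j) f j.
Proof.
move=> pS Ff; have pN : finset.partition p N1 by case/and3P: pS.
rewrite big_imset/=; last exact: imset_cell_inj pN hinj.
by rewrite (big_corresponds _ _ pS); apply: eq_bigr.
Qed.

Lemma big_side_neq p (S : Svec n) (C0 : {set 'I_n.+1}) (F : {set J} -> V) (f : 'I_n.+1 -> V) :
  corresponds p S -> C0 \in p ->
  (forall C, C \in p -> F (h @: C)%SET = f (cmax C)) ->
  \big[op/idx]_(D in [set h @: (C : {set 'I_n.+1}) | C in p]%SET | D != (h @: C0)%SET) F D =
  \big[op/idx]_(j | jump S j && (j != cmax C0)) f j.
Proof.
move=> pS C0p Ff; have pN : finset.partition p N1 by case/and3P: pS.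
rewrite big_mkcondr (@big_side p S _ (fun j => if j != cmax C0 then f j else idx))//.
  by rewrite [RHS]big_mkcondr.
move=> C Cp; rewrite (inj_in_eq (imset_cell_inj pN hinj))// Ff//.
by rewrite (inj_in_eq (corresponds_inj pS)).
Qed.

End BigSides.

Lemma rem_catl (T : eqType) (x : T) (s t : seq T) : x \in s -> rem x (s ++ t) = rem x s ++ t.
Proof. by elim: s => //= y s IH; rewrite inE eq_sym; case: eqP => //= _ /IH ->. Qed.

Section TwoSides.
Context (R : comPzRingType) (chi : seq nat -> R).
Hypothesis chi_sym : forall e e', all (leq 1) e -> perm_eq e e' -> chi e = chi e'.
Context (J : finType) (x : J) (n1 n2 : nat) (h1 : 'I_n1.+1 -> J) (h2 : 'I_n2.+1 -> J).
Local Notation N1 n := (~: [set ord0 : 'I_n.+1])%SET.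
Hypotheses (h1inj : {in N1 n1 &, injective h1}) (h2inj : {in N1 n2 &, injective h2}).
Let A1 := (h1 @: N1 n1)%SET.
Let A2 := (h2 @: N1 n2)%SET.
Hypotheses (dA : [disjoint A1 & A2]) (xA1 : x \notin A1) (xA2 : x \notin A2).

Let cells1 (p : {set {set 'I_n1.+1}}) := [set h1 @: (C : {set 'I_n1.+1}) | C in p]%SET.
Let cells2 (p : {set {set 'I_n2.+1}}) := [set h2 @: (C : {set 'I_n2.+1}) | C in p]%SET.

Definition pure (C : {set J}) := (C \subset A1) || (C \subset A2).

(** Mixed cells being excluded, a partition is a pair of partitions of the two
    sides, and each of them may be replaced by its path as soon as the summand
    depends on the paths only. *)
Lemma sum_partition_two_sided (F : {set {set J}} -> R) (Phi : Svec n2 -> Svec n1 -> R) :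
  (forall p, finset.partition p (A1 :|: A2)%SET ->
     (exists2 C, C \in p & ~~ pure C) -> F p = 0) ->
  (forall p1 p2 S1 S2, corresponds p1 S1 -> corresponds p2 S2 ->
     F (cells1 p1 :|: cells2 p2)%SET = Phi S2 S1) ->
  \sum_(p | finset.partition p (A1 :|: A2)%SET) F p =
  \sum_(S1 : Svec n1 | is_Spath S1) \sum_(S2 : Svec n2 | is_Spath S2)
     #|Spartitions S1|%:R * #|Spartitions S2|%:R * Phi S2 S1.
Proof.
move=> F0 FPhi; rewrite sum_partition_split//; last first.
  by move=> p pA [C Cp CA]; apply: F0 => //; exists C; rewrite // /pure negb_or.
rewrite sum_partition_imset// sum_partition_Spath; apply: eq_bigr => S1 _.
under eq_bigr => p1 _ do rewrite sum_partition_imset// sum_partition_Spath.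
rewrite exchange_big/=; apply: eq_bigr => S2 _.
transitivity (\sum_(p1 in Spartitions S1) \sum_(p2 in Spartitions S2) Phi S2 S1).
  apply: eq_bigr => p1; rewrite finset.inE => p1S; apply: eq_bigr => p2.
  by rewrite finset.inE => p2S; exact: FPhi.
by rewrite !sumr_const -mulrnA mulnC -natrM mulr_natl.
Qed.

Context (w : {set J} -> R) (w0 : R).
Context (mom1 ext1 : 'I_n1.+1 -> nat -> R) (mom2 ext2 : 'I_n2.+1 -> nat -> R).
Hypotheses
  (w1E : forall C : {set 'I_n1.+1}, C \subset N1 n1 -> C != finset.set0 -> w (h1 @: C)%SET = mom1 (cmax C) #|C|)
  (w2E : forall C : {set 'I_n2.+1}, C \subset N1 n2 -> C != finset.set0 -> w (h2 @: C)%SET = mom2 (cmax C) #|C|)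
  (wx1E : forall C : {set 'I_n1.+1}, C \subset N1 n1 -> C != finset.set0 -> w (x |: (h1 @: C))%SET = ext1 (cmax C) #|C|)
  (wx2E : forall C : {set 'I_n2.+1}, C \subset N1 n2 -> C != finset.set0 -> w (x |: (h2 @: C))%SET = ext2 (cmax C) #|C|)
  (wmixed : forall C : {set J}, ~~ pure (C :\ x)%SET -> w C = 0)
  (w0E : w [set x]%SET = w0).

Lemma mem_mults n (S : Svec n) j : jump S j -> incr S j \in mults S.
Proof. by move=> Sj; apply/mapP; exists j; rewrite // mem_filter Sj mem_enum. Qed.

Let cells_disjoint p1 p2 : finset.partition p1 (N1 n1) -> finset.partition p2 (N1 n2) ->
  [disjoint cells1 p1 & cells2 p2].
Proof.
move=> p1N p2N; apply/pred0Pn => -[D /andP[/= D1 D2]].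
have c1 := partition_imset h1inj p1N; have c2 := partition_imset h2inj p2N.
have /finset.set0Pn[y yD] := partition_neq0 c1 D1.
have yA := fintype.subsetP (partitionS c1 D1) y yD.
by have := disjointFr dA yA; rewrite (fintype.subsetP (partitionS c2 D2)).
Qed.

Let corr_partition n p (S : Svec n) : corresponds p S -> finset.partition p (N1 n).
Proof. by case/and3P. Qed.

Section Pair.
Context (p1 : {set {set 'I_n1.+1}}) (p2 : {set {set 'I_n2.+1}}) (S1 : Svec n1) (S2 : Svec n2).
Hypotheses (pS1 : corresponds p1 S1) (pS2 : corresponds p2 S2).
Let p1N := corr_partition pS1.
Let p2N := corr_partition pS2.
Let dC := cells_disjoint p1N p2N.
Let p := (cells1 p1 :|: cells2 p2)%SET.

Let pA : finset.partition p (A1 :|: A2)%SET.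
Proof. by apply: partition_setU => //; exact: partition_imset. Qed.

Let p_sizes : perm_eq (sizes p) (mults S1 ++ mults S2).
Proof.
apply: (perm_trans (sizesU dC)); apply: perm_cat.
  exact: perm_trans (sizes_imset p1N h1inj) (perm_mults pS1).
exact: perm_trans (sizes_imset p2N h2inj) (perm_mults pS2).
Qed.

Let p_pos := sizes_gt0 pA.

Let w1cell C : C \in p1 -> w (h1 @: C)%SET = mom1 (cmax C) (incr S1 (cmax C)).
Proof.
move=> Cp; have [_ ->] := corresponds_jump pS1 Cp.
by apply: w1E; [exact: partitionS p1N Cp | exact: partition_neq0 p1N Cp].
Qed.

Let w2cell C : C \in p2 -> w (h2 @: C)%SET = mom2 (cmax C) (incr S2 (cmax C)).
Proof.
move=> Cp; have [_ ->] := corresponds_jump pS2 Cp.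
by apply: w2E; [exact: partitionS p2N Cp | exact: partition_neq0 p2N Cp].
Qed.

Let prod1 : \prod_(D in cells1 p1) w D = \prod_(j | jump S1 j) mom1 j (incr S1 j).
Proof. by apply: big_side => // C /w1cell. Qed.

Let prod2 : \prod_(D in cells2 p2) w D = \prod_(j | jump S2 j) mom2 j (incr S2 j).
Proof. by apply: big_side => // C /w2cell. Qed.

Let prod_all : \prod_(D in p) w D =
  \prod_(j | jump S1 j) mom1 j (incr S1 j) * \prod_(j | jump S2 j) mom2 j (incr S2 j).
Proof. by rewrite /p big_setU_disjoint// prod1 prod2. Qed.

Let prod_D1 C : C \in p1 -> \prod_(D in (p :\ (h1 @: C))%SET) w D =
  \prod_(j | jump S1 j && (j != cmax C)) mom1 j (incr S1 j) *
  \prod_(j | jump S2 j) mom2 j (incr S2 j).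
Proof.
move=> Cp; have C1 : (h1 @: C)%SET \in cells1 p1 by apply: imset_f.
have -> : (p :\ (h1 @: C) = (cells1 p1 :\ (h1 @: C)) :|: cells2 p2)%SET.
  apply/setP => D; rewrite !finset.inE; case: eqP => //= ->.
  by rewrite (disjointFr dC C1).
rewrite big_setU_disjoint; last exact: disjointWl (finset.subsetDl _ _) dC.
rewrite prod2; congr (_ * _).
rewrite (eq_bigl (fun D => (D \in cells1 p1) && (D != (h1 @: C)%SET))); last first.
  by move=> D; rewrite !finset.inE andbC.
by apply: big_side_neq => // D /w1cell.
Qed.

Let prod_D2 C : C \in p2 -> \prod_(D in (p :\ (h2 @: C))%SET) w D =
  \prod_(j | jump S1 j) mom1 j (incr S1 j) *
  \prod_(j | jump S2 j && (j != cmax C)) mom2 j (incr S2 j).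
Proof.
move=> Cp; have C2 : (h2 @: C)%SET \in cells2 p2 by apply: imset_f.
have -> : (p :\ (h2 @: C) = cells1 p1 :|: (cells2 p2 :\ (h2 @: C)))%SET.
  apply/setP => D; rewrite !finset.inE; case: eqP => //= ->.
  by rewrite (disjointFl dC C2).
rewrite big_setU_disjoint; last exact: disjointWr (finset.subsetDl _ _) dC.
rewrite prod1; congr (_ * _).
rewrite (eq_bigl (fun D => (D \in cells2 p2) && (D != (h2 @: C)%SET))); last first.
  by move=> D; rewrite !finset.inE andbC.
by apply: big_side_neq => // D /w2cell.
Qed.

Let x_notin D : D \in p -> x \notin D.
Proof.
move=> Dp; have := partitionS pA Dp; apply: contraTN => xD; apply/negP => /fintype.subsetP.
by move=> /(_ x xD); rewrite finset.inE (negbTE xA1) (negbTE xA2).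
Qed.

Let sizes_new : perm_eq (sizes ([set x] |: p)%SET) (mults S1 ++ mults S2 ++ [:: 1%N]).
Proof.
apply: (@perm_trans _ (1%N :: sizes p)).
  rewrite -[X in X :: sizes p](finset.cards1 x); apply: sizesU1.
  by apply/negP => /x_notin; rewrite finset.inE eqxx.
by rewrite catA cats1 perm_sym perm_rcons perm_cons perm_sym.
Qed.

Let sizes_join D m : D \in p -> #|D| = m ->
  perm_eq (sizes ((x |: D) |: (p :\ D))%SET) (m.+1 :: rem m (mults S1 ++ mults S2)).
Proof.
move=> Dp Dm; apply: (@perm_trans _ (m.+1 :: sizes (p :\ D)%SET)).
  have {1}<- : #|(x |: D)%SET| = m.+1 by rewrite finset.cardsU1 x_notin// Dm.
  apply: sizesU1; apply/negP; rewrite finset.inE => /andP[_ /x_notin].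
  by rewrite setU11.
rewrite perm_cons -Dm; apply: (perm_trans (sizesD1 Dp)); apply: perm_rem p_sizes.
by apply/mapP; exists D; rewrite ?mem_enum.
Qed.

Let x_join_notin D : D \in p -> (x |: D)%SET \notin (p :\ D)%SET.
Proof.
by move=> Dp; apply/negP; rewrite finset.inE => /andP[_ /x_notin]; rewrite setU11.
Qed.

Let sizes_join_gt0 D : D \in p -> all (leq 1) (sizes ((x |: D) |: (p :\ D))%SET).
Proof.
move=> Dp; rewrite (perm_all _ (sizesU1 (x_join_notin Dp)))/= finset.cardsU1 x_notin//=.
rewrite (perm_all _ (sizesD1 Dp)); apply/allP => k /mem_rem; exact: (allP p_pos).
Qed.

Lemma pair_weight : chi (sizes p) * \prod_(D in p) w D =
  chi (mults S1 ++ mults S2) *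
  (\prod_(j | jump S1 j) mom1 j (incr S1 j) * \prod_(j | jump S2 j) mom2 j (incr S2 j)).
Proof. by rewrite prod_all (chi_sym p_pos p_sizes). Qed.

Lemma pair_weight_new :
  chi (sizes ([set x] |: p)%SET) * \prod_(D in ([set x] |: p)%SET) w D =
  chi (mults S1 ++ mults S2 ++ [:: 1%N]) * w0 *
  (\prod_(j | jump S1 j) mom1 j (incr S1 j) * \prod_(j | jump S2 j) mom2 j (incr S2 j)).
Proof.
rewrite big_setU1/=; last by apply/negP => /x_notin; rewrite finset.inE eqxx.
have s1 : all (leq 1) (sizes ([set x] |: p)%SET).
  by rewrite (perm_all _ sizes_new) catA all_cat -(perm_all _ p_sizes) p_pos.
by rewrite prod_all w0E (chi_sym s1 sizes_new) !mulrA.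
Qed.

Lemma pair_weight_join :
  \sum_(D in p) chi (sizes ((x |: D) |: (p :\ D))%SET) *
     \prod_(E in ((x |: D) |: (p :\ D))%SET) w E =
  \sum_(j | jump S1 j)
     chi (rem (incr S1 j) (mults S1) ++ mults S2 ++ [:: (incr S1 j).+1]) *
     ext1 j (incr S1 j) *
     (\prod_(k | jump S1 k && (k != j)) mom1 k (incr S1 k) *
      \prod_(k | jump S2 k) mom2 k (incr S2 k)) +
  \sum_(j | jump S2 j)
     chi (mults S1 ++ rem (incr S2 j) (mults S2) ++ [:: (incr S2 j).+1]) *
     ext2 j (incr S2 j) *
     (\prod_(k | jump S1 k) mom1 k (incr S1 k) *
      \prod_(k | jump S2 k && (k != j)) mom2 k (incr S2 k)).
Proof.
rewrite (@big_setU_disjoint _ _ _ _ (cells1 p1) (cells2 p2))//; congr (_ + _).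
- apply: (big_side _ h1inj pS1) => C Cp.
  have [jC iC] := corresponds_jump pS1 Cp.
  have Cp' : (h1 @: C)%SET \in p by rewrite finset.inE imset_f.
  have Ccard : #|(h1 @: C)%SET| = incr S1 (cmax C).
    by rewrite iC; exact: card_imset_cell p1N h1inj Cp.
  rewrite big_setU1 ?x_join_notin//= prod_D1// wx1E; last 2 first.
  + exact: partitionS p1N Cp.
  + exact: partition_neq0 p1N Cp.
  rewrite -iC !mulrA; congr (_ * _ * _ * _); apply: chi_sym; first exact: sizes_join_gt0.
  apply: (perm_trans (sizes_join Cp' Ccard)).
  by rewrite rem_catl ?mem_mults// catA cats1 perm_sym perm_rcons.
- apply: (big_side _ h2inj pS2) => C Cp.
  have [jC iC] := corresponds_jump pS2 Cp.
  have Cp' : (h2 @: C)%SET \in p by rewrite finset.inE imset_f ?orbT.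
  have Ccard : #|(h2 @: C)%SET| = incr S2 (cmax C).
    by rewrite iC; exact: card_imset_cell p2N h2inj Cp.
  rewrite big_setU1 ?x_join_notin//= prod_D2// wx2E; last 2 first.
  + exact: partitionS p2N Cp.
  + exact: partition_neq0 p2N Cp.
  rewrite -iC !mulrA; congr (_ * _ * _ * _); apply: chi_sym; first exact: sizes_join_gt0.
  apply: (perm_trans (sizes_join Cp' Ccard)).
  rewrite catA cats1 perm_sym perm_rcons perm_cons.
  rewrite (permPl (permEl (perm_catC _ _))) -rem_catl ?mem_mults//.
  by apply: perm_rem; [rewrite mem_cat mem_mults|rewrite perm_catC].
Qed.

End Pair.

Let pure_notin (C : {set J}) : x \notin C -> ~~ pure C -> w C = 0.
Proof.
move=> xC nC; apply: wmixed; suff -> : (C :\ x)%SET = C by [].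
by apply/setP => y; rewrite !finset.inE; case: eqP => // ->; rewrite (negbTE xC).
Qed.

Let xA : x \notin (A1 :|: A2)%SET.
Proof. by rewrite finset.inE negb_or xA1. Qed.

Let xcell p D : finset.partition p (A1 :|: A2)%SET -> D \in p -> x \notin D.
Proof.
by move=> pA Dp; apply: contra xA; exact: (fintype.subsetP (partitionS pA Dp)).
Qed.

Let prod_eq0 (Q : {set {set J}}) D : D \in Q -> w D = 0 -> \prod_(E in Q) w E = 0.
Proof. by move=> DQ wD; rewrite (big_setD1 D)//= wD mul0r. Qed.

(** The weight of a cell is a function of its maximum and of its size, hence
    the product over the cells is a product over the jumps of the two paths. *)
Lemma sum_partition_paths :
  \sum_(p | finset.partition p (A1 :|: A2)%SET) chi (sizes p) * \prod_(C in p) w C =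
  \sum_(S1 : Svec n1 | is_Spath S1) \sum_(S2 : Svec n2 | is_Spath S2)
     #|Spartitions S1|%:R * #|Spartitions S2|%:R *
     (chi (mults S1 ++ mults S2) *
      (\prod_(j | jump S1 j) mom1 j (incr S1 j) * \prod_(j | jump S2 j) mom2 j (incr S2 j))).
Proof.
apply: sum_partition_two_sided => [p pA [C Cp nC]|p1 p2 S1 S2 pS1 pS2]; last exact: pair_weight.
by rewrite (prod_eq0 Cp) ?mulr0// pure_notin// (xcell pA).
Qed.

(** The new point opens a cell, joins a cell of the first side, or joins a cell
    of the second side; these are the three groups of terms. *)
Lemma sum_partition_paths_add_point :
  \sum_(p | finset.partition p (x |: (A1 :|: A2))%SET) chi (sizes p) * \prod_(C in p) w C =
  \sum_(S1 : Svec n1 | is_Spath S1) \sum_(S2 : Svec n2 | is_Spath S2)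
     #|Spartitions S1|%:R * #|Spartitions S2|%:R *
     (chi (mults S1 ++ mults S2 ++ [:: 1%N]) * w0 *
        (\prod_(j | jump S1 j) mom1 j (incr S1 j) * \prod_(j | jump S2 j) mom2 j (incr S2 j)) +
      \sum_(j | jump S1 j)
        chi (rem (incr S1 j) (mults S1) ++ mults S2 ++ [:: (incr S1 j).+1]) *
        ext1 j (incr S1 j) *
        (\prod_(k | jump S1 k && (k != j)) mom1 k (incr S1 k) *
         \prod_(k | jump S2 k) mom2 k (incr S2 k)) +
      \sum_(j | jump S2 j)
        chi (mults S1 ++ rem (incr S2 j) (mults S2) ++ [:: (incr S2 j).+1]) *
        ext2 j (incr S2 j) *
        (\prod_(k | jump S1 k) mom1 k (incr S1 k) *
         \prod_(k | jump S2 k && (k != j)) mom2 k (incr S2 k))).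
Proof.
rewrite sum_partition_add_point//.
apply: sum_partition_two_sided => [p pA [C Cp nC]|p1 p2 S1 S2 pS1 pS2].
  have wC : w C = 0 by rewrite pure_notin// (xcell pA).
  rewrite (@prod_eq0 _ C) ?mulr0 ?add0r//; last by rewrite finset.inE Cp orbT.
  apply: big1 => D Dp; have [DC|DC] := eqVneq D C.
    rewrite (@prod_eq0 _ (x |: D)%SET) ?mulr0 ?setU11//; apply: wmixed.
    by rewrite finset.setU1K ?(xcell pA)// DC.
  by rewrite (@prod_eq0 _ C) ?mulr0// !finset.inE Cp (eq_sym C) DC orbT.
by rewrite (pair_weight_new pS1 pS2) (pair_weight_join pS1 pS2) addrA.
Qed.

End TwoSides.

(** * Mixtures of kernels *)

Local Open Scope classical_set_scope.

Section Mixtures.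
Local Open Scope ereal_scope.
Import HBNNSimple.
Context (R : realType) dX (X : measurableType dX).

Section Kernel.
Context d (Om : measurableType d) (P : {measure set Om -> \bar R}) (k : R.-pker Om ~> X)
  (F : Om -> R).
Hypotheses (mF : measurable_fun setT F) (F0 : forall w, (0 <= F w)%R).

Lemma measurable_integral_pker (g : X -> \bar R) : measurable_fun setT g ->
  (forall x, 0 <= g x) -> measurable_fun setT (fun w => \int[k w]_x g x).
Proof.
move=> mg g0.
apply: (measurable_fun_integral_finite_kernel (fun z : Om * X => g z.2) k) => //.
exact: measurableT_comp.
Qed.

(** Both integrations commute with increasing limits, so it suffices to expand
    the simple functions that increase to [g]. *)
Lemma mixture_lim (g : X -> \bar R) (f : {nnsfun X >-> R}^nat) :
  measurable_fun setT g -> (forall x, 0 <= g x) ->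
  nondecreasing_seq (f : (X -> R)^nat) -> (forall x, (f n x)%:E @[n --> \oo] --> g x) ->
  (\sum_(r \in range (f n)) r%:E * \int[P]_w (k w (f n @^-1` [set r]) * (F w)%:E))
     @[n --> \oo] --> \int[P]_w ((\int[k w]_x g x) * (F w)%:E).
Proof.
move=> mg g0 ndf fg.
have mk U : measurable U -> measurable_fun setT (fun w => k w U).
  by move=> mU; apply: measurable_kernel.
have mEF : measurable_fun setT (fun w => (F w)%:E) by apply/measurable_EFinP.
have mfn n : measurable_fun setT (fun w => (\int[k w]_x (f n x)%:E) * (F w)%:E).
  apply: emeasurable_funM => //; apply: measurable_integral_pker => [|x].
    exact/measurable_EFinP.
  by rewrite lee_fin.
rewrite (_ : (fun n => _) = fun n => \int[P]_w ((\int[k w]_x (f n x)%:E) * (F w)%:E)).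
  rewrite (_ : \int[P]_w _ =
      \int[P]_w limn (fun n => (\int[k w]_x (f n x)%:E) * (F w)%:E)); last first.
    apply: eq_integral => w _; apply/esym/cvg_lim => //; apply: cvgeZr => //.
    rewrite (_ : \int[k w]_x g x = \int[k w]_x limn (fun n => (f n x)%:E)).
      apply: cvg_monotone_convergence => //.
      - by move=> n; exact/measurable_EFinP.
      - by move=> n x _; rewrite lee_fin.
      - by move=> x _ m n mn; rewrite lee_fin; have /lefP := ndf _ _ mn; apply.
    by apply: eq_integral => x _; apply/esym/cvg_lim.
  apply: (@cvg_monotone_convergence _ _ _ _ setT measurableT
    (fun n w => (\int[k w]_x (f n x)%:E) * (F w)%:E)) => //.
  - move=> n w _; apply: mule_ge0; last by rewrite lee_fin.
    by apply: integral_ge0 => x _; rewrite lee_fin.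
  - move=> w _ m n mn; apply: lee_pmul => //.
    + by apply: integral_ge0 => x _; rewrite lee_fin.
    + by rewrite lee_fin.
    + apply: ge0_le_integral => //.
      * by move=> x _; rewrite lee_fin.
      * exact/measurable_EFinP.
      * exact/measurable_EFinP.
      * by move=> x _; rewrite lee_fin; have /lefP := ndf _ _ mn; apply.
apply/funext => n.
have mr r : measurable (f n @^-1` [set r]) by exact: measurable_funPTI.
have kF0 r w : 0 <= k w (f n @^-1` [set r]) * (F w)%:E.
  by rewrite mule_ge0// lee_fin.
have mkF r : measurable_fun setT (fun w => k w (f n @^-1` [set r]) * (F w)%:E).
  by apply: emeasurable_funM => //; exact: mk.
transitivity (\sum_(r \in range (f n))
    \int[P]_w (r%:E * (k w (f n @^-1` [set r]) * (F w)%:E))).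
  apply: eq_fsbigr => r; rewrite inE => -[x _ <-].
  by rewrite ge0_integralZl// lee_fin.
rewrite -ge0_integral_fsum//.
- apply: eq_integral => w _.
  rewrite integralT_nnsfun sintegralE ge0_mule_fsuml//.
    by apply: eq_fsbigr => r _; rewrite muleA.
  by move=> r; apply: nnsfun_mulemu_ge0.
- by move=> r; apply: measurable_funeM.
- move=> r w _; rewrite muleA mule_ge0 ?lee_fin//.
  by apply: nnsfun_mulemu_ge0.
Qed.

End Kernel.

(** Two mixtures that agree on sets agree on nonnegative functions.  It will be
    applied to the random measure on one side and, on the other side, to the
    Dirac kernel, whose mixtures are plain integrals with a density. *)
Lemma mixture_eq d1 (O1 : measurableType d1) d2 (O2 : measurableType d2)
    (P1 : {measure set O1 -> \bar R}) (P2 : {measure set O2 -> \bar R})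
    (k1 : R.-pker O1 ~> X) (k2 : R.-pker O2 ~> X) (F1 : O1 -> R) (F2 : O2 -> R)
    (g : X -> \bar R) :
  measurable_fun setT F1 -> (forall w, (0 <= F1 w)%R) ->
  measurable_fun setT F2 -> (forall w, (0 <= F2 w)%R) ->
  measurable_fun setT g -> (forall x, 0 <= g x) ->
  (forall B, measurable B -> \int[P1]_w (k1 w B * (F1 w)%:E) =
                             \int[P2]_w (k2 w B * (F2 w)%:E)) ->
  \int[P1]_w ((\int[k1 w]_x g x) * (F1 w)%:E) =
  \int[P2]_w ((\int[k2 w]_x g x) * (F2 w)%:E).
Proof.
move=> mF1 F10 mF2 F20 mg g0 e.
pose f := nnsfun_approx measurableT mg.
have ndf : nondecreasing_seq (f : (X -> R)^nat) by move=> m n mn; exact: nd_nnsfun_approx.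
have fg x : (f n x)%:E @[n --> \oo] --> g x by exact: cvg_nnsfun_approx.
have l1 := mixture_lim (P := P1) (k := k1) mF1 F10 mg g0 ndf fg.
have l2 := mixture_lim (P := P2) (k := k2) mF2 F20 mg g0 ndf fg.
rewrite -(cvg_lim _ l1)// -(cvg_lim _ l2)//; congr (limn _); apply/funext => n.
apply: eq_fsbigr => r _; congr (_ * _); apply: e.
exact: measurable_funPTI.
Qed.

End Mixtures.

(** * The partition formula for means of functions *)

Section BoundedFunctions.
Context (R : realType).
Local Notation measR := (measurableTypeR R).
Implicit Types (mu : probability measR R) (g : R -> R).

(** A class stable under sums and products in which all means are finite, so
    that expectations of products of means can be written with real numbers. *)
Record bounded_nonneg g : Prop := {
  bn_meas : measurable_fun [set: measR] (g : measR -> measR) ;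
  bn_ge0 : forall x, 0 <= g x ;
  bn_bound : exists M, forall x, g x <= M }.

Lemma bounded_nonneg_indic (B : set measR) : measurable B -> bounded_nonneg \1_B.
Proof.
move=> mB; split; first exact: measurable_indic.
- by move=> x.
- by exists 1 => x; rewrite indicE lern1 leq_b1.
Qed.

Lemma bounded_nonneg_cst (a : R) : 0 <= a -> bounded_nonneg (fun=> a).
Proof. by move=> a0; split; [exact: measurable_cst|by []|exists a]. Qed.

Lemma bounded_nonnegM g h : bounded_nonneg g -> bounded_nonneg h ->
  bounded_nonneg (fun x => g x * h x).
Proof.
move=> [mg g0 [M gM]] [mh h0 [M' hM']]; split.
- exact: measurable_funM.
- by move=> x; rewrite mulr_ge0.
- by exists (M * M') => x; apply: ler_pM.
Qed.

Lemma bounded_nonnegD g h : bounded_nonneg g -> bounded_nonneg h ->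
  bounded_nonneg (fun x => g x + h x).
Proof.
move=> [mg g0 [M gM]] [mh h0 [M' hM']]; split.
- exact: measurable_funD.
- by move=> x; rewrite addr_ge0.
- by exists (M + M') => x; apply: lerD.
Qed.

Lemma measurable_bigprod d (Om : measurableType d) (I : Type) (s : seq I) (Q : pred I)
    (h : I -> Om -> measR) : (forall i, Q i -> measurable_fun setT (h i)) ->
  measurable_fun setT (fun w => \prod_(i <- s | Q i) (h i w : R) : measR).
Proof.
move=> mh; elim: s => [|i s IH].
  rewrite (_ : (fun w => _) = fun=> 1); first exact: measurable_cst.
  by apply/funext => x; rewrite big_nil.
rewrite (_ : (fun w => _) = fun w => if Q i then h i w * \prod_(j <- s | Q j) (h j w : R)
  else \prod_(j <- s | Q j) (h j w : R)); last by apply/funext => x; rewrite big_cons.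
by case Qi : (Q i) => //; apply: measurable_funM => //; exact: mh.
Qed.

Lemma bounded_nonneg_prod (I : Type) (s : seq I) (Q : pred I) (g : I -> R -> R) :
  (forall i, Q i -> bounded_nonneg (g i)) ->
  bounded_nonneg (fun x => \prod_(i <- s | Q i) g i x).
Proof.
move=> bg; elim: s => [|i s IH].
  rewrite [X in bounded_nonneg X](_ : _ = fun=> 1).
    exact: bounded_nonneg_cst.
  by apply/funext => x; rewrite big_nil.
rewrite [X in bounded_nonneg X](_ : _ = fun x => if Q i then g i x * \prod_(j <- s | Q j) g j x
  else \prod_(j <- s | Q j) g j x); last by apply/funext => x; rewrite big_cons.
case Qi : (Q i) => //; have bi := bg i Qi; exact: bounded_nonnegM.
Qed.

Lemma bounded_nonneg_sum (I : Type) (s : seq I) (Q : pred I) (g : I -> R -> R) :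
  (forall i, Q i -> bounded_nonneg (g i)) ->
  bounded_nonneg (fun x => \sum_(i <- s | Q i) g i x).
Proof.
move=> bg; elim: s => [|i s IH].
  rewrite [X in bounded_nonneg X](_ : _ = fun=> 0).
    exact: bounded_nonneg_cst.
  by apply/funext => x; rewrite big_nil.
rewrite [X in bounded_nonneg X](_ : _ = fun x => if Q i then g i x + \sum_(j <- s | Q j) g j x
  else \sum_(j <- s | Q j) g j x); last by apply/funext => x; rewrite big_cons.
case Qi : (Q i) => //; have bi := bg i Qi; exact: bounded_nonnegD.
Qed.

Definition mean mu g : R := \int[mu]_x g x.

Lemma mean_ge0 mu g : (forall x, 0 <= g x) -> 0 <= mean mu g.
Proof. by move=> g0; apply: Rintegral_ge0. Qed.

Lemma bounded_integrable mu g : bounded_nonneg g -> mu.-integrable setT (EFin \o g).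
Proof.
move=> [mg g0 [M gM]].
apply: (@le_integrable _ _ _ _ setT measurableT _ (EFin \o cst M)).
- exact/measurable_EFinP.
- move=> x _ /=; rewrite lee_fin !ger0_norm//.
  exact: le_trans (g0 x) (gM x).
- exact: finite_measure_integrable_cst.
Qed.

Lemma meanE mu g : bounded_nonneg g -> (mean mu g)%:E = (\int[mu]_x (g x)%:E)%E.
Proof.
move=> bg; rewrite fineK//.
exact/integrable_fin_num/bounded_integrable.
Qed.

Lemma meanD mu g h : bounded_nonneg g -> bounded_nonneg h ->
  mean mu (fun x => g x + h x) = mean mu g + mean mu h.
Proof. by move=> bg bh; rewrite /mean RintegralD//; exact: bounded_integrable. Qed.

Lemma meanZ mu a g : bounded_nonneg g -> mean mu (fun x => a * g x) = a * mean mu g.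
Proof. by move=> bg; rewrite /mean RintegralZl//; exact: bounded_integrable. Qed.

Lemma mean0 mu : mean mu (fun=> 0) = 0.
Proof. by rewrite /mean Rintegral_cst// mul0r. Qed.

Lemma mean1 mu : mean mu (fun=> 1) = 1.
Proof. by rewrite /mean Rintegral_cst// mul1r; have -> : fine (mu [set: measR]) = 1 by rewrite probability_setT. Qed.

Lemma mean_sum mu (I : Type) (s : seq I) (Q : pred I) (g : I -> R -> R) :
  (forall i, Q i -> bounded_nonneg (g i)) ->
  mean mu (fun x => \sum_(i <- s | Q i) g i x) = \sum_(i <- s | Q i) mean mu (g i).
Proof.
move=> bg; elim: s => [|i s IH].
  rewrite big_nil -[RHS](mean0 mu); congr (mean mu _).
  by apply/funext => x; rewrite big_nil.
rewrite [X in mean mu X](_ : _ = fun x => if Q i then g i x + \sum_(j <- s | Q j) g j x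
  else \sum_(j <- s | Q j) g j x); last by apply/funext => x; rewrite big_cons.
rewrite big_cons; case Qi : (Q i) => //.
by rewrite meanD ?IH//; [exact: bg|exact: bounded_nonneg_sum].
Qed.

Lemma mean_indic mu (B : set measR) : measurable B -> mean mu \1_B = fine (mu B).
Proof. by move=> mB; rewrite /mean /Rintegral integral_indic// setIT. Qed.

Lemma le_mean mu g h : bounded_nonneg g -> bounded_nonneg h ->
  (forall x, g x <= h x) -> mean mu g <= mean mu h.
Proof.
by move=> bg bh gh; apply: le_Rintegral => //; exact: bounded_integrable.
Qed.

End BoundedFunctions.

Section FunctionalEPPF.
Context (R : realType) d (Omega : measurableType d) (P : probability Omega R).
Local Notation measR := (measurableTypeR R).
Context (H : probability measR R) (G : {RV P >-> pprobability measR R}) (chi : seq nat -> R)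
  (Hchi : is_eppf H G chi).

Definition random_kernel : R.-pker Omega ~> measR :=
  kprobability (measurable_funPT G : measurable_fun setT G).

Lemma measurable_mean g : bounded_nonneg g ->
  measurable_fun setT (fun w => mean (G w) g : measR).
Proof.
move=> bg; apply/measurable_EFinP.
rewrite (_ : EFin \o _ = fun w => \int[random_kernel w]_x (g x)%:E)%E; last first.
  apply/funext => w /=; exact (meanE (G w) bg).
apply: measurable_integral_pker; first by apply/measurable_EFinP; exact: (bn_meas bg).
by move=> x; rewrite lee_fin (bn_ge0 bg).
Qed.

(** Isolates one of the functions: the sum is linear in [g i0], and the other
    factors form a density against which [g i0] is integrated. *)
Lemma sum_partition_mean (I : finType) (i0 : I) (g : I -> R -> R) :
  (forall i, bounded_nonneg (g i)) ->
  let F x := \sum_(p | finset.partition p [set: I]%SET) chi (sizes p) *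
     (\prod_(C in p | C != finset.pblock p i0) mean H (fun y => \prod_(i in C) g i y) *
      \prod_(i in finset.pblock p i0 | i != i0) g i x) in
  bounded_nonneg F /\ 
  \sum_(p | finset.partition p [set: I]%SET) chi (sizes p) *
    \prod_(C in p) mean H (fun x => \prod_(i in C) g i x) =
  mean H (fun x => g i0 x * F x).
Proof.
move=> bg F.
have chi0 (p : {set {set I}}) : finset.partition p [set: I]%SET -> 0 <= chi (sizes p).
  by move=> /sizes_gt0; apply: (eppf_ge0 Hchi).
have bC (C : {set I}) : bounded_nonneg (fun y => \prod_(i in C) g i y).
  exact: bounded_nonneg_prod.
pose c (p : {set {set I}}) := chi (sizes p) *
   \prod_(C in p | C != finset.pblock p i0) mean H (fun y => \prod_(i in C) g i y).
pose h (p : {set {set I}}) x := \prod_(i in finset.pblock p i0 | i != i0) g i x.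
have c0 p : finset.partition p [set: I]%SET -> 0 <= c p.
  move=> pA; rewrite mulr_ge0 ?chi0//; apply: prodr_ge0 => C _.
  by apply: mean_ge0; exact: (bn_ge0 (bC C)).
have bh p : bounded_nonneg (h p) by exact: bounded_nonneg_prod.
have FE : F = fun x => \sum_(p | finset.partition p [set: I]%SET) c p * h p x.
  by apply/funext => x; apply: eq_bigr => p _; rewrite mulrA.
split.
  rewrite FE; apply: bounded_nonneg_sum => p pA; apply: bounded_nonnegM => //.
  by apply: bounded_nonneg_cst; exact: c0.
rewrite FE.
rewrite [X in mean H X](_ : _ = fun x =>
    \sum_(p | finset.partition p [set: I]%SET) g i0 x * (c p * h p x)); last first.
  by apply/funext => x; rewrite mulr_sumr.
rewrite mean_sum; last first.
  move=> p pA; apply: bounded_nonnegM => //; apply: bounded_nonnegM => //.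
  by apply: bounded_nonneg_cst; exact: c0.
apply: eq_bigr => p pA.
have i0p : i0 \in finset.cover p by rewrite (cover_partition pA) finset.inE.
rewrite (bigD1 (finset.pblock p i0)) ?pblock_mem//=.
rewrite (_ : (fun x => g i0 x * (c p * h p x)) = fun x => c p * (g i0 x * h p x)); last first.
  by apply/funext => x; rewrite mulrCA.
rewrite meanZ; last exact: bounded_nonnegM.
rewrite /c -[RHS]mulrA; congr (_ * _); rewrite [RHS]mulrC; congr (_ * _).
by congr (mean H _); apply/funext => x; rewrite (bigD1 i0) ?mem_pblock.
Qed.

(** The formula for sets extends to functions one coordinate at a time: with
    the other coordinates fixed, both sides are mixtures of the integral of the
    remaining function, so they are equal as soon as they agree on sets. *)
Lemma eppf_mean_ord N (g : 'I_N -> R -> R) : (forall i, bounded_nonneg (g i)) ->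
  (\int[P]_w (\prod_(i < N) mean (G w) (g i))%:E =
   (\sum_(p | finset.partition p [set: 'I_N]%SET) chi (sizes p) *
     \prod_(C in p) mean H (fun x => \prod_(i in C) g i x))%:E)%E.
Proof.
(* In [claim m] the coordinates from [m] on are still indicators. *)
suff claim m : (m <= N)%N -> forall g : 'I_N -> R -> R, (forall i, bounded_nonneg (g i)) ->
    (forall i : 'I_N, (m <= i)%N -> exists2 B : set measR, measurable B & g i = \1_B) ->
  (\int[P]_w (\prod_(i < N) mean (G w) (g i))%:E =
   (\sum_(p | finset.partition p [set: 'I_N]%SET) chi (sizes p) *
     \prod_(C in p) mean H (fun x => \prod_(i in C) g i x))%:E)%E.
  move=> bg; apply: (claim N) => // i; rewrite leqNgt ltn_ord.
  by [].
elim: m => [_ {}g bg gB|m IH mN {}g bg gB].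
  pose B i := sval (cid2 (gB i (leq0n _))).
  have mB i : measurable (B i) by rewrite /B; case: cid2.
  have gE i : g i = \1_(B i) by rewrite /B; case: cid2.
  have := eppf_joint Hchi mB => e.
  transitivity (\int[P]_w \prod_(i < N) (G w : probability measR R) (B i))%E.
    apply: eq_integral => w _; rewrite -prodEFin; apply: eq_bigr => i _.
    by rewrite gE mean_indic// fineK// fin_num_measure.
  rewrite e -sumEFin; apply: eq_bigr => p pA; rewrite EFinM; congr (_ * _)%E.
  rewrite -prodEFin; apply: eq_bigr => C Cp.
  have mC : measurable (\bigcap_(i in [set` C]) B i).
    by apply: fin_bigcap_measurable => //; exact: finite_finset.
  rewrite -(fineK (fin_num_measure _ _ mC)) -mean_indic//; congr ((mean H _)%:E).
  apply/funext => x; rewrite indicE.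
  have [|nB] := boolP (x \in _).
    rewrite inE => xB; rewrite big1// => i iC; rewrite gE indicE mem_set//.
    exact: xB.
  apply/esym/eqP/prodf_eq0.
  have : ~ (\bigcap_(i in [set` C]) B i) x by move=> /mem_set; apply/negP.
  move/existsNP => [i /not_implyP[iC nBi]]; exists i => //.
  by rewrite gE indicE memNset.
have im : (m < N)%N by [].
pose i0 := Ordinal im.
pose upd u i := if i == i0 then u else g i.
have bupd u : bounded_nonneg u -> forall i, bounded_nonneg (upd u i).
  by move=> bu i; rewrite /upd; case: ifP.
pose F x := \sum_(p | finset.partition p [set: 'I_N]%SET) chi (sizes p) *
     (\prod_(C in p | C != finset.pblock p i0) mean H (fun y => \prod_(i in C) g i y) *
      \prod_(i in finset.pblock p i0 | i != i0) g i x).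
have [bF gF] := sum_partition_mean i0 bg; rewrite -/F in bF gF.
pose Phi w := \prod_(i < N | i != i0) mean (G w) (g i).
have mPhi : measurable_fun setT (Phi : Omega -> measR).
  by apply: measurable_bigprod => i _; exact: measurable_mean.
have Phi0 w : 0 <= Phi w.
  by apply: prodr_ge0 => i _; apply: mean_ge0; exact: (bn_ge0 (bg i)).
have uF u : bounded_nonneg u ->
   \sum_(p | finset.partition p [set: 'I_N]%SET) chi (sizes p) *
     \prod_(C in p) mean H (fun x => \prod_(i in C) upd u i x) =
   mean H (fun x => u x * F x).
  move=> bu; have [_ ->] := sum_partition_mean i0 (bupd u bu).
  congr (mean H _); apply/funext => x; rewrite /upd eqxx; congr (_ * _).
  apply: eq_bigr => p pA; congr (_ * (_ * _)).
    apply: eq_bigr => C /andP[Cp Ci0]; congr (mean H _); apply/funext => y.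
    apply: eq_bigr => i iC; case: eqP => // ii0.
    by move: Ci0; rewrite -ii0 (def_pblock (partition_trivIset pA) Cp iC) eqxx.
  by apply: eq_bigr => i /andP[_ /negbTE ->].
have uPhi u w : \prod_(i < N) mean (G w) (upd u i) = mean (G w) u * Phi w.
  rewrite (bigD1 i0)//= /upd eqxx; congr (_ * _).
  by apply: eq_bigr => i /negbTE ->.
have updg : upd (g i0) = g.
  by apply/funext => i; rewrite /upd; case: eqP => // ->.
(* Against the Dirac kernel a mixture over [H] is an integral over [H]. *)
pose kd : R.-pker measR ~> measR := kdirac (@measurable_id _ measR setT).
have main := @mixture_eq R _ measR _ Omega _ measR P H random_kernel kd Phi F (fun x => (g i0 x)%:E)
  mPhi Phi0 (bn_meas bF) (bn_ge0 bF).
rewrite -{1}updg gF meanE; last exact: bounded_nonnegM.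
transitivity (\int[P]_w ((\int[random_kernel w]_x (g i0 x)%:E) * (Phi w)%:E))%E.
  by apply: eq_integral => w _; rewrite uPhi EFinM meanE.
rewrite main; last 3 first.
- by apply/measurable_EFinP; exact: (bn_meas (bg i0)).
- by move=> x; rewrite lee_fin (bn_ge0 (bg i0)).
- move=> B mB.
  have bB := bounded_nonneg_indic mB.
  transitivity (\int[P]_w (\prod_(i < N) mean (G w) (upd \1_B i))%:E)%E.
    apply: eq_integral => w _; rewrite uPhi EFinM mean_indic// fineK//.
    exact: fin_num_measure.
  rewrite IH ?(ltnW mN)//; [|exact: bupd|]; last first.
    move=> i mi; rewrite /upd; case: eqP => [_|/eqP ii0]; first by exists B.
    apply: gB; rewrite ltn_neqAle mi andbT.
    by apply: contra ii0 => /eqP e; apply/eqP/val_inj.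
  rewrite uF// meanE; last exact: bounded_nonnegM.
  apply: eq_integral => x _; rewrite EFinM; congr (_ * _)%E.
apply: eq_integral => x _; rewrite EFinM; congr (_ * _)%E.
rewrite integral_dirac ?diracT ?mul1e//.
by apply/measurable_EFinP; exact: (bn_meas (bg i0)).
Qed.

End FunctionalEPPF.

(** * Nonatomic laws and the addition rule *)

Section Nonatomic.
Context (R : realType).
Local Notation measR := (measurableTypeR R).
Context (H : probability measR R) (nonatomic : forall x : R, H [set x] = 0%E).

Lemma measurable_below (x : R) : measurable ([set y | (y <= x)%R] : set measR).
Proof. by rewrite -set_itvNyc. Qed.

Lemma measurable_above (x : R) : measurable ([set y | (x < y)%R] : set measR).
Proof. by rewrite -set_itvoy. Qed.

(** Otherwise every rational cut leaves one side of [A] null.  Deleting these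
    countably many null sides leaves at most one point, since two points would
    be separated by a rational; then [A] would be null. *)
Lemma nonatomic_split (A : set measR) : measurable A -> (0 < H A)%E ->
  exists x : R, (0 < H (A `&` [set y | (y <= x)%R]))%E /\
                (0 < H (A `&` [set y | (x < y)%R]))%E.
Proof.
move=> mA HA; apply/not_existsP => nx.
pose lo (x : R) := A `&` [set y | (y <= x)%R].
pose hi (x : R) := A `&` [set y | (x < y)%R].
have mlo x : measurable (lo x).
  by apply: measurableI => //; exact: measurable_below.
have mhi x : measurable (hi x).
  by apply: measurableI => //; exact: measurable_above.
have ge0P (B : set measR) : ~ (0 < H B)%E -> H B = 0%E.
  move=> /negP; rewrite -leNgt => HB.
  by apply/eqP; rewrite eq_le HB measure_ge0.
(* [E] enumerates, over the rational cuts, a side of [A] that is null. *)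
pose E (n : nat) : set measR := if @unpickle rat n is Some q then
   (if `[< (0 < H (lo (ratr q)))%E >] then hi (ratr q) else lo (ratr q)) else set0.
have EN n : H.-negligible (E n).
  rewrite /E; case: unpickle => [q|]; last exact: negligible_set0.
  case: asboolP => [h|/ge0P h]; last by apply/negligibleP.
  apply/negligibleP => //; apply: ge0P => h'; exact: (nx (ratr q)).
have EU := negligible_bigcup EN.
have AU : A `\` \bigcup_n E n = set0 \/ exists x, A `\` \bigcup_n E n `<=` [set x].
  have [->|/set0P[x [Ax nEx]]] := eqVneq (A `\` \bigcup_n E n) set0; first by left.
  right; exists x => y [Ay nEy] /=; apply/eqP; apply: contrapT => /negP yx.
  wlog : x y Ax nEx Ay nEy yx / x < y.
    move=> W; move: (yx); rewrite neq_lt => /orP[] xy.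
      by apply: (W y x) => //; rewrite eq_sym.
    exact: (W x y).
  move=> xy; have [q] := rat_in_itvoo xy; rewrite in_itv /= => /andP[xq qy].
  have [m Em] : exists m, E m =
      if `[< (0 < H (lo (ratr q)))%E >] then hi (ratr q) else lo (ratr q).
    by exists (pickle q); rewrite /E pickleK.
  case: (asboolP (0 < H (lo (ratr q)))%E) Em => _ Em.
    by apply: nEy; exists m => //; rewrite Em.
  by apply: nEx; exists m => //; rewrite Em; split => //=; exact: ltW.
have : H.-negligible A.
  have sub : A `<=` (\bigcup_n E n) `|` (A `\` \bigcup_n E n).
    by move=> y Ay; have [?|?] := pselect ((\bigcup_n E n) y); [left|right].
  apply: (negligibleS sub).
  apply: negligibleU => //; case: AU => [->|[x]]; first exact: negligible_set0.
  move=> /negligibleS; apply; apply/negligibleP => //; exact: nonatomic.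
by move=> /negligibleP -/(_ mA) e; rewrite e ltxx in HA.
Qed.

Lemma nonatomic_disjoint (k : nat) (A : set measR) : measurable A -> (0 < H A)%E ->
  exists S : nat -> set measR,
    [/\ forall j, measurable (S j),
        forall j, (j < k)%N -> (0 < H (S j))%E,
        forall j, S j `<=` A &
        forall i j x, S i x -> S j x -> i = j].
Proof.
elim: k A => [|k IH] A mA HA.
  exists (fun=> set0); split => //.
  by move=> j; exact: sub0set.
have [x [lo hi]] := nonatomic_split mA HA.
have mlo : measurable (A `&` [set y | (y <= x)%R] : set measR).
  by apply: measurableI => //; exact: measurable_below.
have mhi : measurable (A `&` [set y | (x < y)%R] : set measR).
  by apply: measurableI => //; exact: measurable_above.
have [S [mS HS SA Sd]] := IH _ mhi hi.
exists (fun j => if j is j'.+1 then S j' else A `&` [set y | (y <= x)%R]); split.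
- by case.
- by case=> [|j] //; rewrite ltnS; exact: HS.
- by case=> [|j] y; [case|move=> /SA[]].
- move=> [|i] [|j] y //.
  + by move=> [_ /= yx] /SA[_ /=]; rewrite ltNge yx.
  + by move=> /SA[_ /= xy] [_ /=]; rewrite leNgt xy.
  + by move=> Si Sj; rewrite (Sd _ _ _ Si Sj).
Qed.

End Nonatomic.

Section Consistency.
Context (R : realType) d (Omega : measurableType d) (P : probability Omega R).
Local Notation measR := (measurableTypeR R).
Context (H : probability measR R) (G : {RV P >-> pprobability measR R}) (chi : seq nat -> R)
  (Hchi : is_eppf H G chi).

Lemma eppf_mean (I : finType) (A : {set I}) (g : I -> R -> R) :
  (forall i, bounded_nonneg (g i)) ->
  (\int[P]_w (\prod_(i in A) mean (G w) (g i))%:E =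
   (\sum_(p | finset.partition p A) chi (sizes p) *
     \prod_(C in p) mean H (fun x => \prod_(i in C) g i x))%:E)%E.
Proof.
move=> bg; pose h (j : 'I_#|A|) : I := enum_val j.
have hinj : {in [set: 'I_#|A|]%SET &, injective h}.
  by move=> i j _ _; exact: enum_val_inj.
have hA : (h @: [set: 'I_#|A|])%SET = A.
  apply/setP => x; apply/imsetP/idP => [[j _ ->]|xA]; first exact: enum_valP.
  by exists (enum_rank_in xA x); rewrite ?finset.inE// /h enum_rankK_in.
transitivity (\int[P]_w (\prod_(j < #|A|) mean (G w) (g (h j)))%:E)%E.
  apply: eq_integral => w _; congr EFin; rewrite -[in LHS]hA big_imset//=.
  by apply: eq_bigl => j; rewrite finset.inE.
rewrite (eppf_mean_ord Hchi)//; congr EFin; rewrite -[in RHS]hA sum_partition_imset//.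
apply: eq_bigr => p pA; congr (_ * _).
  apply: (eppf_sym Hchi); first exact: (sizes_gt0 pA).
  by rewrite perm_sym; apply: sizes_imset pA hinj.
rewrite big_imset/=; last first.
  move=> C D _ _; apply: imset_inj; exact: enum_val_inj.
apply: eq_bigr => C Cp; congr (mean H _); apply/funext => x.
by rewrite big_imset//= => i j _ _; exact: enum_val_inj.
Qed.

Lemma mean_prod_disjoint (I : finType) (S : I -> set measR) (C : {set I}) i j x :
  (\prod_(k in C) (\1_(S k) x : R)) != 0 -> i \in C -> j \in C -> S i x /\ S j x.
Proof.
move=> /prodf_neq0 nz iC jC; split.
  by have := nz _ iC; rewrite indicE; case: (boolP (x \in S i)) => [|_]; rewrite ?inE// eqxx.
by have := nz _ jC; rewrite indicE; case: (boolP (x \in S j)) => [|_]; rewrite ?inE// eqxx.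
Qed.

(** The graph of the equivalence relation of [p] on [A].  Refinement of
    partitions becomes inclusion. *)
Definition blocked (I : finType) (A : {set I}) (p : {set {set I}}) : {set I * I} :=
  [set ij | (ij.1 \in A) && (ij.2 \in finset.pblock p ij.1)]%SET.

Lemma blocked_inj (I : finType) (A : {set I}) (p q : {set {set I}}) :
  finset.partition p A -> finset.partition q A -> blocked A p = blocked A q -> p = q.
Proof.
suff sub (p1 q1 : {set {set I}}) : finset.partition p1 A -> finset.partition q1 A ->
    blocked A p1 = blocked A q1 -> p1 \subset q1.
  by move=> pA qA e; apply/eqP; rewrite finset.eqEsubset !sub.
move: p1 q1 => {}p {}q pA qA e; apply/fintype.subsetP => C Cp.
have /finset.set0Pn[x xC] := partition_neq0 pA Cp.
have xA := fintype.subsetP (partitionS pA Cp) x xC.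
suff -> : C = finset.pblock q x by rewrite pblock_mem// (cover_partition qA).
rewrite -(def_pblock (partition_trivIset pA) Cp xC); apply/setP => y.
have : ((x, y) \in blocked A p) = ((x, y) \in blocked A q) by rewrite e.
by rewrite !finset.inE /= xA.
Qed.

Hypothesis nonatomic : forall x : R, H [set x] = 0%E.

(** The products over the cells are linearly independent functionals.  Among
    the partitions with a nonzero coefficient choose [p] with the smallest
    equivalence relation, and give to all the points of a cell of [p] the
    indicator of the same set, different cells receiving disjoint sets of
    positive mass.  Only refinements of [p] contribute, and by minimality [p]
    is the only one whose coefficient is nonzero. *)
Lemma partition_weights_eq0 (I : finType) (A : {set I}) (D : {set {set I}} -> R) :
  (forall g : I -> R -> R, (forall i, bounded_nonneg (g i)) ->
   \sum_(p | finset.partition p A) D p *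
     \prod_(C in p) mean H (fun x => \prod_(i in C) g i x) = 0) ->
  forall p, finset.partition p A -> D p = 0.
Proof.
move=> D0 p0 p0A; apply: contrapT => /eqP Dp0.
pose Q p := finset.partition p A && (D p != 0).
have Qp0 : Q p0 by rewrite /Q p0A.
case: (arg_minnP (fun p => #|blocked A p|) Qp0) => p /andP[pA Dp] pmin.
have H0 : (0 < H setT)%E by rewrite probability_setT.
have [S [mS HS _ Sd]] := nonatomic_disjoint nonatomic #|p| (@measurableT _ measR) H0.
pose cell i := finset.pblock p i.
pose g i : R -> R := \1_(S (index (cell i) (enum p))).
have bg i : bounded_nonneg (g i) by exact: bounded_nonneg_indic.
have := D0 g bg; rewrite (bigD1 p)//= [X in _ + X]big1 ?addr0; last first.
  move=> q /andP[qA qp].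
  have [->|Dq] := eqVneq (D q) 0; first by rewrite mul0r.
  have /existsP[C /andP[Cq Cij]] : [exists C in q, [exists i in C, [exists j in C, cell i != cell j]]].
    apply: contraNT qp => /existsPn h.
    have sub : blocked A q \subset blocked A p.
      apply/fintype.subsetP => -[i j]; rewrite !finset.inE /= => /andP[iA ij].
      have Cq : finset.pblock q i \in q by rewrite pblock_mem// (cover_partition qA).
      have iC : i \in finset.pblock q i by rewrite mem_pblock (cover_partition qA).
      have := h (finset.pblock q i); rewrite Cq /= => /existsPn /(_ i).
      rewrite iC /= => /existsPn /(_ j); rewrite ij /= negbK => /eqP e.
      have jA : j \in A by apply: (fintype.subsetP (partitionS qA Cq)).
      by rewrite iA -/(cell i) e /cell mem_pblock (cover_partition pA).
    apply/eqP/(@blocked_inj _ A) => //; apply/eqP; rewrite eqEcard sub /=.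
    by apply: pmin; rewrite /Q qA.
  have /existsP[i /andP[iC /existsP[j /andP[jC ij]]]] := Cij.
  rewrite (bigD1 C)//= (_ : mean H _ = 0) ?mul0r ?mulr0//.
  rewrite -[RHS](mean0 H); congr (mean H _); apply/funext => x.
  apply/eqP; apply: contraNT ij => nz.
  have [Si Sj] := mean_prod_disjoint nz iC jC.
  have CA := fintype.subsetP (partitionS qA Cq).
  have := Sd _ _ _ Si Sj; move=> e.
  have cp k : k \in C -> cell k \in enum p.
    by move=> /CA kA; rewrite mem_enum pblock_mem// (cover_partition pA).
  by rewrite -(nth_index finset.set0 (cp _ iC)) e nth_index// cp.
move=> /eqP; rewrite mulf_eq0 (negbTE Dp) /= => /eqP/eqP.
apply/negP/prodf_neq0 => C Cp.
have CE : (fun x => \prod_(i in C) g i x) = \1_(S (index C (enum p))).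
  apply/funext => x; have /finset.set0Pn[i0 i0C] := partition_neq0 pA Cp.
  have gE i : i \in C -> g i = \1_(S (index C (enum p))).
    by move=> iC; rewrite /g /cell (def_pblock (partition_trivIset pA) Cp iC).
  rewrite (eq_bigr (fun=> \1_(S (index C (enum p))) x)); last by move=> i /gE ->.
  rewrite prodr_const indicE; case: (x \in _); first by rewrite expr1n.
  by rewrite expr0n -[#|C| == 0%N]negbK -lt0n card_gt0 (partition_neq0 pA Cp).
rewrite CE mean_indic//; apply/lt0r_neq0/fine_gt0; rewrite HS /=; last first.
  by rewrite cardE index_mem mem_enum.
by rewrite -ge0_fin_numE// fin_num_measure.
Qed.

(** Adjoining a point that carries the constant function [1] changes no product
    of means, whereas the formula for the larger sample distributes each
    partition over its extensions.  Linear independence identifies the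
    coefficients. *)
Lemma eppf_addition (I : finType) (x : I) (A : {set I}) (p : {set {set I}}) :
  x \notin A -> finset.partition p A ->
  chi (sizes p) = chi (sizes ([set x] |: p)%SET) +
    \sum_(C in p) chi (sizes ((x |: C) |: (p :\ C))%SET).
Proof.
move=> xA pA; apply/eqP; rewrite -subr_eq0; apply/eqP.
apply: (partition_weights_eq0 (A := A) (D := fun p => chi (sizes p) -
  (chi (sizes ([set x] |: p)%SET) + \sum_(C in p) chi (sizes ((x |: C) |: (p :\ C))%SET)))) pA.
move=> {p} g bg.
(* The mean of [1] is [1], so the point [x] leaves the products unchanged. *)
pose g' i := if i == x then (fun=> 1) : R -> R else g i.
have bg' i : bounded_nonneg (g' i).
  by rewrite /g'; case: ifP => // _; exact: bounded_nonneg_cst.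
have gE i : i \in A -> g' i = g i.
  by rewrite /g'; case: eqP => // -> ; rewrite (negbTE xA).
have e1 := eppf_mean A bg; have := eppf_mean (x |: A)%SET bg'.
rewrite (_ : \int[P]_w _ = \int[P]_w (\prod_(i in A) mean (G w) (g i))%:E)%E; last first.
  apply: eq_integral => w _; rewrite big_setU1//= /g' eqxx mean1 mul1r.
  by congr EFin; apply: eq_bigr => i /gE; rewrite /g' => ->.
rewrite e1 => -[]; rewrite sum_partition_add_point// => e.
apply/eqP; under eq_bigr do rewrite mulrBl.
rewrite sumrB subr_eq0 e; apply/eqP; apply: eq_bigr => p pA.
have xC C : C \in p -> x \notin C.
  by move=> Cp; apply: contra xA; exact: (fintype.subsetP (partitionS pA Cp)).
have mC C : C \in p -> mean H (fun y => \prod_(i in C) g' i y) =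
    mean H (fun y => \prod_(i in C) g i y).
  move=> Cp; congr (mean H _); apply/funext => y; apply: eq_bigr => i iC.
  by rewrite gE//; exact: (fintype.subsetP (partitionS pA Cp)).
rewrite mulrDl; congr (_ + _).
  rewrite big_setU1/=; last first.
    by apply/negP => /xC; rewrite finset.inE eqxx.
  rewrite (_ : mean H _ = 1) ?mul1r; last first.
    rewrite -[RHS](mean1 H); congr (mean H _); apply/funext => y.
    by rewrite big_set1 /g' eqxx.
  by congr (_ * _); apply: eq_bigr => C Cp; exact: mC.
rewrite mulr_suml; apply: eq_bigr => C Cp; congr (_ * _).
rewrite big_setU1/=; last first.
  by rewrite !finset.inE negb_and; apply/orP; right; apply/negP => /xC; rewrite setU11.
rewrite [RHS](big_setD1 C)//=; congr (_ * _).
  rewrite -mC//; congr (mean H _); apply/funext => y.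
  by rewrite big_setU1 ?xC//= /g' eqxx mul1r.
by apply: eq_bigr => D; rewrite finset.inE => /andP[_ Dp]; exact: mC.
Qed.

End Consistency.

Section Vanishing.
Context (R : realType) d (Omega : measurableType d) (P : probability Omega R).
Local Notation measR := (measurableTypeR R).
Context (H : probability measR R) (G : {RV P >-> pprobability measR R}) (chi : seq nat -> R)
  (Hchi : is_eppf H G chi) (nonatomic : forall x : R, H [set x] = 0%E).

Lemma chi_perm e e' : all (leq 1) e -> perm_eq e e' -> chi e = chi e'.
Proof. exact: (eppf_sym Hchi). Qed.

(** The terms of the addition rule are nonnegative, so they vanish with their
    sum. *)
Lemma chi_eq0_addition e : all (leq 1) e -> chi e = 0 ->
  chi (1%N :: e) = 0 /\ (forall m, m \in e -> chi (m.+1 :: rem m e) = 0).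
Proof.
move=> e1 chi0; have [I [x [A [p [xA pA pe]]]]] := sizes_surj e1.
have xp C : C \in p -> x \notin C.
  by move=> Cp; apply: contra xA; exact: (fintype.subsetP (partitionS pA Cp)).
have nxp : [set x]%SET \notin p by apply/negP => /xp; rewrite finset.inE eqxx.
have nxC C : C \in p -> (x |: C)%SET \notin (p :\ C)%SET.
  by move=> Cp; apply/negP; rewrite finset.inE => /andP[_ /xp]; rewrite setU11.
have s1 : perm_eq (sizes ([set x] |: p)%SET) (1%N :: e).
  by apply: (perm_trans (sizesU1 nxp)); rewrite finset.cards1 perm_cons.
have sC C : C \in p -> perm_eq (sizes ((x |: C) |: (p :\ C))%SET) (#|C|.+1 :: rem #|C| e).
  move=> Cp; apply: (perm_trans (sizesU1 (nxC C Cp))).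
  rewrite finset.cardsU1 xp// add1n perm_cons.
  apply: (perm_trans (sizesD1 Cp)); apply: perm_rem pe.
  by apply/mapP; exists C; rewrite ?mem_enum.
have all1 : all (leq 1) (1%N :: e) by [].
have allm m : all (leq 1) (m.+1 :: rem m e).
  by rewrite /=; apply/allP => k /mem_rem; exact: (allP e1).
have := eppf_addition Hchi nonatomic xA pA.
rewrite (chi_perm _ pe); last by rewrite (perm_all _ pe).
rewrite chi0 -(chi_perm all1 (_ : perm_eq _ (sizes _))); last by rewrite perm_sym.
have ge C : C \in p -> 0 <= chi (sizes ((x |: C) |: (p :\ C))%SET).
  by move=> Cp; rewrite (eppf_ge0 Hchi)// (perm_all _ (sC C Cp)).
move=> /esym/eqP; rewrite paddr_eq0 ?(eppf_ge0 Hchi)//; last exact: sumr_ge0.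
move=> /andP[/eqP -> /eqP s0]; split=> // m me.
have : m \in sizes p by rewrite (perm_mem pe).
move=> /mapP[C]; rewrite mem_enum => Cp ->.
rewrite (chi_perm (allm _) (_ : perm_eq _ (sizes ((x |: C) |: (p :\ C))%SET))).
  exact: (psumr_eq0P ge s0).
by rewrite perm_sym sC.
Qed.

(** The points of [e'] are added one at a time, each as a new singleton that is
    then enlarged. *)
Lemma chi_eq0_cat e e' : all (leq 1) e -> all (leq 1) e' -> chi e = 0 ->
  chi (e ++ e') = 0.
Proof.
elim: e' e => [|m e' IH] e e1 /=; first by rewrite cats0.
move=> /andP[m1 e'1] chi0.
have : chi (m :: e) = 0.
  case: m m1 => [//|m _]; elim: m => [|m IHm].
    by have [] := chi_eq0_addition e1 chi0.
  have [|_ /(_ m.+1)] := chi_eq0_addition _ IHm; first by rewrite /= e1.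
  by rewrite mem_head /= eqxx => ->.
move=> /(IH (m :: e)); rewrite /= m1 e1 e'1 => <- //.
apply: chi_perm; last by rewrite -cat1s perm_catCA.
by rewrite all_cat e1 /= m1.
Qed.

End Vanishing.

(** * The kernel of the unimodal density *)

Section Kernel.
Context (R : realType).
Local Notation measR := (measurableTypeR R).
Implicit Types (th t x : R).

Lemma measurable_invr : measurable_fun setT (fun x : measR => (x^-1 : measR)).
Proof.
have o0 : open (~` [set (0 : R)]) by apply: closed_openC; exact: closed_eq.
have m0 : measurable_fun (~` [set (0 : R)]) (fun x : R => x^-1).
  apply: open_continuous_measurable_fun => // x; rewrite inE => /eqP x0.
  exact: inv_continuous.
rewrite -(setUv [set 0]); apply/measurable_funU.
- exact: measurable_set1.
- by apply: measurableC; exact: measurable_set1.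
by split; first exact: measurable_fun_set1.
Qed.

(** The density of a uniform law between [th] and [th + x], evaluated at [t]:
    its mean under a mixing law is the unimodal density at [t]. *)
Definition ukern th t x : R :=
  x^-1 * (((0 < t - th) && (t - th <= x))%R%:R - ((x <= t - th) && (t - th < 0))%R%:R).

Lemma ukern_pos th t x : th < t -> ukern th t x = x^-1 * (t - th <= x)%R%:R.
Proof. by move=> tht; rewrite /ukern subr_gt0 subr_lt0 tht (lt_gtF tht) andbF subr0. Qed.

Lemma ukern_neg th t x : t < th -> ukern th t x = (- x)^-1 * (x <= t - th)%R%:R.
Proof.
move=> tht; rewrite /ukern subr_gt0 subr_lt0 tht (lt_gtF tht) andbT sub0r.
by rewrite invrN mulrN mulNr.
Qed.

Lemma ukern_eq th x : ukern th th x = 0.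
Proof. by rewrite /ukern subrr ltxx andbF subr0 mulr0. Qed.

Lemma measurable_ukern d (Om : measurableType d) (f g : Om -> measR) t :
  measurable_fun setT f -> measurable_fun setT g ->
  measurable_fun setT (fun w => ukern (f w) t (g w) : measR).
Proof.
move=> mf mg; have mB (b : Om -> bool) : measurable_fun setT b ->
    measurable_fun setT (fun w => ((b w)%:R : measR)).
  move=> mb; rewrite (_ : (fun w => _) = fun w => if b w then 1 else 0 : R).
    exact: measurable_fun_ifT.
  by apply/funext => w; case: (b w).
have mtf : measurable_fun setT (fun w => t - f w : measR).
  by apply: measurable_funB => //; exact: measurable_cst.
apply: measurable_funM; first exact: (measurableT_comp measurable_invr).
apply: measurable_funB; apply: mB; apply: measurable_and.
- exact: measurable_fun_ltr.
- exact: measurable_fun_ler.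
- exact: measurable_fun_ler.
- exact: measurable_fun_ltr.
Qed.

Lemma bounded_nonneg_ukern th t : bounded_nonneg (ukern th t).
Proof.
split.
- by apply: measurable_ukern => //; exact: measurable_cst.
- move=> x; have [tht|tht|->] := ltgtP th t.
  + rewrite ukern_pos//; case: (leP (t - th) x) => h; last by rewrite mulr0.
    by rewrite mulr1 invr_ge0 (le_trans _ h)// subr_ge0 ltW.
  + rewrite ukern_neg//; case: (leP x (t - th)) => h; last by rewrite mulr0.
    by rewrite mulr1 invr_ge0 oppr_ge0 (le_trans h)// subr_le0 ltW.
  + by rewrite ukern_eq.
- exists `|t - th|^-1 => x; have [tht|tht|->] := ltgtP th t.
  + rewrite ukern_pos//; case: (leP (t - th) x) => h; last by rewrite mulr0 invr_ge0.
    have p : 0 < t - th by rewrite subr_gt0.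
    by rewrite mulr1 gtr0_norm// lef_pV2// posrE// (lt_le_trans p).
  + rewrite ukern_neg//; case: (leP x (t - th)) => h; last by rewrite mulr0 invr_ge0.
    have p : t - th < 0 by rewrite subr_lt0.
    rewrite mulr1 ltr0_norm// lef_pV2 ?posrE ?oppr_gt0//; last exact: le_lt_trans p.
    by rewrite lerN2.
  + by rewrite ukern_eq invr_ge0.
Qed.

Lemma upper_momentE (H : probability measR R) a m :
  upper_moment H a m = mean H (fun x => x^-1 ^+ m * (a <= x)%R%:R).
Proof.
rewrite /upper_moment Rintegral_mkcond; congr (mean H _); apply/funext => x.
rewrite patchE; case: (leP a x) => ax.
  by rewrite mem_set/= ?in_itv/= ?ax// mulr1 exprVn.
by rewrite memNset/= ?in_itv/= ?andbT ?mulr0//; apply/negP; rewrite -ltNge.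
Qed.

Lemma lower_momentE (H : probability measR R) b m :
  lower_moment H b m = mean H (fun x => (- x)^-1 ^+ m * (x <= b)%R%:R).
Proof.
rewrite /lower_moment Rintegral_mkcond; congr (mean H _); apply/funext => x.
rewrite patchE; case: (leP x b) => ax.
  by rewrite mem_set/= ?in_itv/= ?ax// mulr1 exprVn.
by rewrite memNset/= ?in_itv/= ?andbT ?mulr0//; apply/negP; rewrite -ltNge.
Qed.

(** The conditions attached to the points of a cell are nested, so that the one
    at the maximum implies the others. *)
Lemma prod_nested n (C : {set 'I_n.+1}) j (r : R) (b : 'I_n.+1 -> bool) :
  cell_max C j -> (forall i, i \in C -> b j -> b i) ->
  \prod_(i in C) (r * (b i)%:R) = r ^+ #|C| * (b j)%:R.
Proof.
move=> /andP[jC _] bC; case bj : (b j).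
  rewrite mulr1 -prodr_const; apply: eq_bigr => i iC.
  by rewrite bC ?bj// mulr1.
by rewrite mulr0 (bigD1 j)//= bj mulr0 mul0r.
Qed.

End Kernel.

Section SortedIndex.
Context (R : realType) (N : nat) (f : 'I_N -> R) (le : rel R) (a : pred 'I_N) (n : nat).
Hypotheses (le_total : total le) (le_trans : transitive le)
  (nE : n = #|[set k | a k]%SET|).
Local Notation N1 := (~: [set ord0 : 'I_n.+1])%SET.

Definition sorted_indices : seq 'I_N := sort (relpre f le) [seq k <- enum 'I_N | a k].

Definition sorted_val (j : nat) : R := nth 0 (sort le [seq f k | k <- enum 'I_N & a k]) j.-1.

(** Positions are counted from 1, as the coordinates of a path are; position 0
    belongs to no cell.  The option type provides a default when there is no
    observation, and a name for the additional point. *)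
Definition sorted_index (j : 'I_n.+1) : option 'I_N := nth None (map Some sorted_indices) j.-1.

Lemma size_sorted_indices : size sorted_indices = n.
Proof.
rewrite size_sort size_filter -sum1_count big_enum_cond /= nE -sum1_card.
by apply: eq_bigl => k; rewrite finset.inE.
Qed.

Lemma uniq_sorted_indices : uniq sorted_indices.
Proof. by rewrite sort_uniq filter_uniq// enum_uniq. Qed.

Lemma mem_sorted_indices k : (k \in sorted_indices) = a k.
Proof. by rewrite mem_sort mem_filter mem_enum andbT. Qed.

Lemma sorted_valE j : sorted_val j = nth 0 (map f sorted_indices) j.-1.
Proof. by rewrite /sorted_val sort_map. Qed.

Lemma N1P (j : 'I_n.+1) : j \in N1 -> (0 < j)%N /\ (j.-1 < n)%N.
Proof.
rewrite !finset.inE => j0.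
have jp : (0 < j)%N by rewrite lt0n; apply: contra j0 => /eqP e; apply/eqP/val_inj.
by split=> //; rewrite -ltnS prednK.
Qed.

Lemma sorted_indexE (j : 'I_n.+1) : j \in N1 ->
  exists k, [/\ sorted_index j = Some k, a k & f k = sorted_val j].
Proof.
move=> /N1P[j0 jn]; have {}jn : (j.-1 < size sorted_indices)%N by rewrite size_sorted_indices.
have k0 : 'I_N by case: sorted_indices jn.
exists (nth k0 sorted_indices j.-1); rewrite /sorted_index (nth_map k0)//.
by rewrite -mem_sorted_indices mem_nth// sorted_valE (nth_map k0).
Qed.

Lemma sorted_index_inj : {in N1 &, injective sorted_index}.
Proof.
move=> i j /N1P[i0 iN] /N1P[j0 jN]; rewrite /sorted_index => /eqP.
rewrite nth_uniq ?size_map ?size_sorted_indices//; last first.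
  by rewrite (map_inj_uniq (@Some_inj _)) uniq_sorted_indices.
by move=> /eqP e; apply: ord_inj; rewrite -(prednK i0) -(prednK j0) e.
Qed.

Lemma sorted_index_image : (sorted_index @: N1)%SET = [set Some k | k in [set k | a k]%SET]%SET.
Proof.
apply/setP => y; apply/imsetP/imsetP => [[j jN ->]|[k]].
  by have [k [-> ak _]] := sorted_indexE jN; exists k; rewrite // finset.inE.
rewrite finset.inE -mem_sorted_indices => ks ->.
have kn : (index k sorted_indices < n)%N by rewrite -size_sorted_indices index_mem.
exists (Ordinal (kn : ((index k sorted_indices).+1 < n.+1)%N)); first by rewrite !finset.inE.
by rewrite /sorted_index /= (nth_map k) ?index_mem// nth_index.
Qed.

Lemma sorted_val_le (i j : 'I_n.+1) : i \in N1 -> j \in N1 -> (i <= j)%N ->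
  le (sorted_val i) (sorted_val j).
Proof.
move=> /N1P[i0 iN] /N1P[j0 jN] ij.
have sz : size (sort le [seq f k | k <- enum 'I_N & a k]) = n.
  by rewrite sort_map size_map size_sorted_indices.
rewrite /sorted_val; apply: (sorted_leq_nth le_trans) => //; rewrite ?inE ?sz//.
- by move=> x; have := le_total x x; rewrite orbb.
- exact: sort_sorted.
- by rewrite -ltnS !prednK.
Qed.

End SortedIndex.

(** * Partition sums at a fixed mode *)

Section FixedTheta.
Context (R : realType).
Local Notation measR := (measurableTypeR R).
Context (H : probability measR R) (N : nat) (T : 'I_N -> R) (th t : R).
Hypothesis nhit : ~~ hits T th.
Local Notation n := (npos T th).
Local Notation n' := (N - npos T th)%N.
Local Notation N1 n := (~: [set ord0 : 'I_n.+1])%SET.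

Let f k := T k - th.
Let a1 k := th < T k.
Let a2 k := T k < th.
Let h1 : 'I_n.+1 -> option 'I_N := sorted_index f <=%R a1 (n := n).
Let h2 : 'I_n'.+1 -> option 'I_N := sorted_index f >=%R a2 (n := n').

Lemma not_hits k : T k != th.
Proof. by move: nhit; rewrite negb_exists => /forallP. Qed.

Lemma nneg_card : n' = #|[set k | T k < th]%SET|.
Proof.
have e : (npos T th + #|(~: [set k | (th < T k)%R])%SET|)%N = N by rewrite finset.cardsC card_ord.
rewrite -[X in (X - _)%N]e addKn.
apply: eq_card => k; rewrite !finset.inE -leNgt le_eqVlt.
by rewrite (negbTE (not_hits k)).
Qed.

Let n1E : n = #|[set k | a1 k]%SET|. Proof. by []. Qed.
Let n2E : n' = #|[set k | a2 k]%SET|. Proof. exact: nneg_card. Qed.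

Let ge_total : total (>=%R : rel R). Proof. by move=> x y; exact: le_total. Qed.
Let ge_trans : transitive (>=%R : rel R). Proof. by move=> x y z xy /le_trans; apply. Qed.

Let YE j : Ydist T th j = sorted_val f <=%R a1 j. Proof. by []. Qed.
Let ZE j : Zdist T th j = sorted_val f >=%R a2 j. Proof. by []. Qed.

Lemma Ydist_gt0 (j : 'I_n.+1) : j \in N1 n -> 0 < Ydist T th j.
Proof. by move=> /(sorted_indexE f <=%R n1E)[k [_ ak fk]]; rewrite YE -fk subr_gt0. Qed.

Lemma Zdist_lt0 (j : 'I_n'.+1) : j \in N1 n' -> Zdist T th j < 0.
Proof. by move=> /(sorted_indexE f >=%R n2E)[k [_ ak fk]]; rewrite ZE -fk subr_lt0. Qed.

Let g (i : option 'I_N) : R -> R := ukern th (if i is Some k then T k else t).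

Let h1inj : {in N1 n &, injective h1}. Proof. exact: sorted_index_inj n1E. Qed.
Let h2inj : {in N1 n' &, injective h2}. Proof. exact: sorted_index_inj n2E. Qed.

Let g1 j x : j \in N1 n -> g (h1 j) x = x^-1 * (Ydist T th j <= x)%R%:R.
Proof.
by move=> /(sorted_indexE f <=%R n1E)[k [e ak fk]]; rewrite /h1 e YE -fk; exact: ukern_pos.
Qed.

Let g2 j x : j \in N1 n' -> g (h2 j) x = (- x)^-1 * (x <= Zdist T th j)%R%:R.
Proof.
by move=> /(sorted_indexE f >=%R n2E)[k [e ak fk]]; rewrite /h2 e ZE -fk; exact: ukern_neg.
Qed.

Lemma cmax_in n0 (C : {set 'I_n0.+1}) : C != finset.set0 -> cmax C \in C.
Proof. by move=> /cmaxP/andP[]. Qed.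

Let cell1 (C : {set 'I_n.+1}) x : C \subset N1 n -> C != finset.set0 ->
  \prod_(i in (h1 @: C)%SET) g i x = x^-1 ^+ #|C| * (Ydist T th (cmax C) <= x)%R%:R.
Proof.
move=> /fintype.subsetP CN C0; rewrite big_imset/=; last by apply: sub_in2 h1inj.
rewrite (eq_bigr (fun j : 'I_n.+1 => x^-1 * (Ydist T th j <= x)%R%:R)); last first.
  by move=> j /CN; exact: g1.
have cm := cmaxP C0; rewrite (prod_nested _ cm)// => i iC; apply: le_trans.
rewrite !YE; apply: (sorted_val_le f (@le_total _ R) (@le_trans _ R) n1E); try exact: CN.
  exact/CN/cmax_in.
by have /andP[_ /forallP/(_ i)/implyP] := cm; apply.
Qed.

Let cell2 (C : {set 'I_n'.+1}) x : C \subset N1 n' -> C != finset.set0 ->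
  \prod_(i in (h2 @: C)%SET) g i x = (- x)^-1 ^+ #|C| * (x <= Zdist T th (cmax C))%R%:R.
Proof.
move=> /fintype.subsetP CN C0; rewrite big_imset/=; last by apply: sub_in2 h2inj.
rewrite (eq_bigr (fun j : 'I_n'.+1 => (- x)^-1 * (x <= Zdist T th j)%R%:R)); last first.
  by move=> j /CN; exact: g2.
have cm := cmaxP C0; rewrite (prod_nested _ cm)// => i iC h; apply: (le_trans h).
rewrite !ZE; apply: (sorted_val_le f ge_total ge_trans n2E); try exact: CN.
  exact/CN/cmax_in.
by have /andP[_ /forallP/(_ i)/implyP] := cm; apply.
Qed.

Definition cell_mean (D : {set option 'I_N}) : R := mean H (fun x => \prod_(i in D) g i x).

Let none1 (C : {set 'I_n.+1}) : C \subset N1 n -> None \notin (h1 @: C)%SET.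
Proof.
move=> /fintype.subsetP CN; apply/imsetP => -[j /CN jN].
by have [k [e _ _]] := sorted_indexE f <=%R n1E jN; rewrite /h1 e.
Qed.

Let none2 (C : {set 'I_n'.+1}) : C \subset N1 n' -> None \notin (h2 @: C)%SET.
Proof.
move=> /fintype.subsetP CN; apply/imsetP => -[j /CN jN].
by have [k [e _ _]] := sorted_indexE f >=%R n2E jN; rewrite /h2 e.
Qed.

Lemma cell_mean1 (C : {set 'I_n.+1}) : C \subset N1 n -> C != finset.set0 ->
  cell_mean (h1 @: C)%SET = upper_moment H (Ydist T th (cmax C)) #|C|.
Proof.
by move=> CN C0; rewrite upper_momentE; congr (mean H _); apply/funext => x; exact: cell1.
Qed.

Lemma cell_mean2 (C : {set 'I_n'.+1}) : C \subset N1 n' -> C != finset.set0 ->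
  cell_mean (h2 @: C)%SET = lower_moment H (Zdist T th (cmax C)) #|C|.
Proof.
by move=> CN C0; rewrite lower_momentE; congr (mean H _); apply/funext => x; exact: cell2.
Qed.

(** The mean of a cell with maximum [j] and size [m] that the point [t] has
    joined; it vanishes when [t] is not on the same side of the mode. *)
Definition joined1 (j : 'I_n.+1) m : R :=
  upper_moment H (Num.max (t - th) (Ydist T th j)) m.+1 * (th < t)%R%:R.

Definition joined2 (j : 'I_n'.+1) m : R :=
  lower_moment H (Num.min (t - th) (Zdist T th j)) m.+1 * (t < th)%R%:R.

Lemma cell_mean_joined1 (C : {set 'I_n.+1}) : C \subset N1 n -> C != finset.set0 ->
  cell_mean (None |: (h1 @: C))%SET = joined1 (cmax C) #|C|.
Proof.
move=> CN C0; have jN := fintype.subsetP CN _ (cmax_in C0).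
have Y0 := Ydist_gt0 jN.
have E x : \prod_(i in (None |: (h1 @: C))%SET) g i x =
    ukern th t x * (x^-1 ^+ #|C| * (Ydist T th (cmax C) <= x)%R%:R).
  by rewrite big_setU1 ?none1//= cell1.
rewrite /joined1; have [tht|tht|e] := ltgtP th t.
- rewrite mulr1 upper_momentE; congr (mean H _); apply/funext => x.
  rewrite E ukern_pos// ge_max; case: (t - th <= x) => //=; last by rewrite !mulr0 mul0r.
  by rewrite mulr1 mulrA -exprS.
- rewrite mulr0 -[RHS](mean0 H); congr (mean H _); apply/funext => x.
  rewrite E ukern_neg//; case: (leP x (t - th)) => xt; last by rewrite mulr0 mul0r.
  case: (leP (Ydist T th (cmax C)) x) => [Yx|]; last by rewrite !mulr0.
  have := lt_le_trans Y0 (le_trans Yx xt); rewrite subr_gt0 => /lt_trans /(_ tht).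
  by rewrite ltxx.
- rewrite mulr0 -[RHS](mean0 H); congr (mean H _); apply/funext => x.
  by rewrite E -e ukern_eq mul0r.
Qed.

Lemma cell_mean_joined2 (C : {set 'I_n'.+1}) : C \subset N1 n' -> C != finset.set0 ->
  cell_mean (None |: (h2 @: C))%SET = joined2 (cmax C) #|C|.
Proof.
move=> CN C0; have jN := fintype.subsetP CN _ (cmax_in C0).
have Z0 := Zdist_lt0 jN.
have E x : \prod_(i in (None |: (h2 @: C))%SET) g i x =
    ukern th t x * ((- x)^-1 ^+ #|C| * (x <= Zdist T th (cmax C))%R%:R).
  by rewrite big_setU1 ?none2//= cell2.
rewrite /joined2; have [tht|tht|e] := ltgtP t th.
- rewrite mulr1 lower_momentE; congr (mean H _); apply/funext => x.
  rewrite E ukern_neg// le_min; case: (x <= t - th) => //=; last by rewrite !mulr0 mul0r.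
  by rewrite mulr1 mulrA -exprS.
- rewrite mulr0 -[RHS](mean0 H); congr (mean H _); apply/funext => x.
  rewrite E ukern_pos//; case: (leP (t - th) x) => xt; last by rewrite mulr0 mul0r.
  case: (leP x (Zdist T th (cmax C))) => [Zx|]; last by rewrite !mulr0.
  have := le_lt_trans (le_trans xt Zx) Z0; rewrite subr_lt0 => /lt_trans /(_ tht).
  by rewrite ltxx.
- rewrite mulr0 -[RHS](mean0 H); congr (mean H _); apply/funext => x.
  by rewrite E e ukern_eq mul0r.
Qed.

Definition single_mean : R :=
  d_plus0 H th t * (th < t)%R%:R + d_minus0 H th t * (t < th)%R%:R.

Lemma cell_mean_single : cell_mean [set None]%SET = single_mean.
Proof.
have E x : \prod_(i in [set None : option 'I_N]%SET) g i x = ukern th t x.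
  by rewrite big_set1.
rewrite /single_mean; have [tht|tht|e] := ltgtP th t.
- rewrite mulr1 mulr0 addr0 /d_plus0 upper_momentE; congr (mean H _); apply/funext => x.
  by rewrite E ukern_pos// expr1.
- rewrite mulr1 mulr0 add0r /d_minus0 lower_momentE; congr (mean H _); apply/funext => x.
  by rewrite E ukern_neg// expr1.
- rewrite !mulr0 addr0 -[RHS](mean0 H); congr (mean H _); apply/funext => x.
  by rewrite E e ukern_eq.
Qed.

Let A1E : (h1 @: N1 n)%SET = [set Some k | k in [set k | a1 k]%SET]%SET.
Proof. exact: sorted_index_image n1E. Qed.

Let A2E : (h2 @: N1 n')%SET = [set Some k | k in [set k | a2 k]%SET]%SET.
Proof. exact: sorted_index_image n2E. Qed.

Let some_mem (a : pred 'I_N) k :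
  (Some k \in [set Some k | k in [set k | a k]%SET]%SET) = a k.
Proof. by rewrite mem_imset ?finset.inE//; exact: Some_inj. Qed.

(** The kernels of two points on opposite sides of the mode have disjoint
    supports. *)
Lemma cell_mean_mixed (D : {set option 'I_N}) : ~~ pure h1 h2 (D :\ None)%SET ->
  cell_mean D = 0.
Proof.
rewrite /pure negb_or => /andP[/fintype.subsetPn[i iD i1] /fintype.subsetPn[j jD j2]].
move: iD jD; rewrite !finset.inE => /andP[iN iD] /andP[jN jD].
case: i iN i1 iD => // k _; rewrite A1E some_mem /a1 -leNgt le_eqVlt (negbTE (not_hits k)) /=.
move=> Tk kD; case: j jN j2 jD => // l _; rewrite A2E some_mem /a2 -leNgt le_eqVlt eq_sym.
rewrite (negbTE (not_hits l)) /= => Tl lD.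
rewrite -[RHS](mean0 H); congr (mean H _); apply/funext => x.
(* [k] lies below the mode and [l] above it. *)
rewrite (bigD1 (Some k))//= (bigD1 (Some l))/=; last first.
  rewrite lD; apply: contraTneq Tl => -[->]; rewrite -leNgt; exact: ltW.
rewrite mulrA /g ukern_neg// ukern_pos//.
case: (leP x (T k - th)) => h; last by rewrite mulr0 !mul0r.
case: (leP (T l - th) x) => h'; last by rewrite !mulr0 mul0r.
have := le_trans h' h; rewrite lerD2r => /le_lt_trans /(_ Tk).
by rewrite ltNge (ltW Tl).
Qed.

Let dA : fintype.disjoint (mem (h1 @: N1 n)%SET) (mem (h2 @: N1 n')%SET).
Proof.
apply/pred0Pn => -[i /andP[/=]]; rewrite A1E A2E => /imsetP[k + ->].
by rewrite finset.inE some_mem => k1; rewrite /a2 (lt_gtF k1).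
Qed.

Lemma data_split : (h1 @: N1 n :|: h2 @: N1 n')%SET = [set Some k | k : 'I_N]%SET.
Proof.
apply/setP => i; rewrite A1E A2E finset.inE; apply/orP/imsetP => [[]/imsetP[k _ ->]|[k _ ->]].
- by exists k.
- by exists k.
- by rewrite !some_mem; apply/orP; rewrite /a1 /a2 -neq_lt eq_sym not_hits.
Qed.

Let none_A1 : None \notin (h1 @: N1 n)%SET. Proof. exact: none1. Qed.
Let none_A2 : None \notin (h2 @: N1 n')%SET. Proof. exact: none2. Qed.

Context (chi : seq nat -> R).
Hypothesis chi_sym : forall e e', all (leq 1) e -> perm_eq e e' -> chi e = chi e'.
Hypothesis chi_eq0_new : forall e, all (leq 1) e -> chi e = 0 -> chi (1%N :: e) = 0.
Hypothesis chi_eq0_join : forall e m, all (leq 1) e -> m \in e -> chi e = 0 ->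
  chi (m.+1 :: rem m e) = 0.
Hypothesis chi_eq0_cat : forall e e', all (leq 1) e -> all (leq 1) e' -> chi e = 0 ->
  chi (e ++ e') = 0.

Lemma mults_gt0 n0 (S : Svec n0) : all (leq 1) (mults S).
Proof.
by apply/allP => _ /mapP[j + ->]; rewrite mem_filter => /andP[Sj _]; rewrite /incr subn_gt0.
Qed.

Let mults2_gt0 (Sp : Svec n) (Sm : Svec n') : all (leq 1) (mults Sp ++ mults Sm).
Proof. by rewrite all_cat !mults_gt0. Qed.

(** The quotient by [chi (mults Sp)] cancels, also when that value is zero,
    because [chi] then vanishes on every extension of the list. *)
Lemma path_weightE (Sm : Svec n') (Sp : Svec n) :
  path_weight H chi Sm Sp = #|Spartitions Sp|%:R * #|Spartitions Sm|%:R *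
    (chi (mults Sp ++ mults Sm) *
     (\prod_(j | jump Sp j) upper_moment H (Ydist T th j) (incr Sp j) *
      \prod_(j | jump Sm j) lower_moment H (Zdist T th j) (incr Sm j))).
Proof.
rewrite /path_weight (negbTE nhit) /phi_plus /phi_minus.
have [c0|c0] := eqVneq (chi (mults Sp)) 0; last by field.
by rewrite c0 chi_eq0_cat// ?mults_gt0// !(mul0r, mulr0).
Qed.

Lemma sum_path_weight :
  \sum_(p | finset.partition p [set Some k | k : 'I_N]%SET) chi (sizes p) *
    \prod_(D in p) cell_mean D =
  \sum_(Sp : Svec n | is_Spath Sp) \sum_(Sm : Svec n' | is_Spath Sm) path_weight H chi Sm Sp.
Proof.
rewrite -data_split; etransitivity.
  exact: (sum_partition_paths chi_sym h1inj h2inj dA none_A1 none_A2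
    (mom1 := fun j m => upper_moment H (Ydist T th j) m)
    (mom2 := fun j m => lower_moment H (Zdist T th j) m)
    cell_mean1 cell_mean2 cell_mean_mixed).
by apply: eq_bigr => Sp _; apply: eq_bigr => Sm _; rewrite path_weightE.
Qed.

(** On the domain of integration the additional factor is at most the inverse
    of [a].  Hence a zero denominator in [d_plus] forces a zero numerator. *)
Lemma upper_moment_joined_eq0 a b m : 0 < a -> a <= b ->
  upper_moment H a m.+1 = 0 -> upper_moment H b m.+2 = 0.
Proof.
move=> a0 ab u0.
have bE c k : 0 < c -> bounded_nonneg (fun x : R => x^-1 ^+ k.+1 * (c <= x)%R%:R).
  move=> c0; rewrite (_ : (fun x => _) = fun x => \prod_(i < k.+1) ukern 0 c x).
    by apply: bounded_nonneg_prod => i _; exact: bounded_nonneg_ukern.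
  apply/funext => x; rewrite prodr_const card_ord ukern_pos// subr0 exprMn.
  by case: (c <= x); rewrite ?expr1n// expr0n.
have b0 := lt_le_trans a0 ab.
apply/eqP; rewrite eq_le; apply/andP; split; last first.
  by rewrite upper_momentE; apply: mean_ge0; exact: (bn_ge0 (bE b m.+1 b0)).
rewrite -(mulr0 a^-1) -u0 !upper_momentE -meanZ; last exact: bE.
apply: le_mean => [||x].
- exact: bE.
- by apply: bounded_nonnegM; [apply: bounded_nonneg_cst; rewrite invr_ge0 ltW|exact: bE].
- have [bx|xb] := leP b x; last first.
    rewrite mulr0 mulr_ge0 ?invr_ge0 ?(ltW a0)//.
    exact: (bn_ge0 (bE a m a0)).
  rewrite (le_trans ab bx) !mulr1 exprS ler_wpM2r//.
    by rewrite exprn_ge0// invr_ge0 (le_trans (ltW b0)).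
  by rewrite lef_pV2 ?posrE ?(le_trans ab)// (lt_le_trans b0).
Qed.

Lemma lower_moment_joined_eq0 a b m : a < 0 -> b <= a ->
  lower_moment H a m.+1 = 0 -> lower_moment H b m.+2 = 0.
Proof.
move=> a0 ba u0.
have bE c k : c < 0 -> bounded_nonneg (fun x : R => (- x)^-1 ^+ k.+1 * (x <= c)%R%:R).
  move=> c0; rewrite (_ : (fun x => _) = fun x => \prod_(i < k.+1) ukern 0 c x).
    by apply: bounded_nonneg_prod => i _; exact: bounded_nonneg_ukern.
  apply/funext => x; rewrite prodr_const card_ord ukern_neg// subr0 exprMn.
  by case: (x <= c); rewrite ?expr1n// expr0n.
have b0 := le_lt_trans ba a0.
apply/eqP; rewrite eq_le; apply/andP; split; last first.
  by rewrite lower_momentE; apply: mean_ge0; exact: (bn_ge0 (bE b m.+1 b0)).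
rewrite -(mulr0 (- a)^-1) -u0 !lower_momentE -meanZ; last exact: bE.
apply: le_mean => [||x].
- exact: bE.
- apply: bounded_nonnegM; last exact: bE.
  by apply: bounded_nonneg_cst; rewrite invr_ge0 oppr_ge0 ltW.
- have [xb|bx] := leP x b; last first.
    rewrite mulr0 mulr_ge0 ?invr_ge0 ?oppr_ge0 ?(ltW a0)//.
    exact: (bn_ge0 (bE a m a0)).
  rewrite (le_trans xb ba) !mulr1 exprS ler_wpM2r//.
    by rewrite exprn_ge0// invr_ge0 oppr_ge0 (le_trans xb)// ltW.
  rewrite lef_pV2 ?posrE ?oppr_gt0 ?lerN2 ?(le_trans xb)//.
  exact: le_lt_trans b0.
Qed.

(** The denominators of the prediction weights and of the ratios of moments
    occur as factors of [path_weight].  When one of them is zero the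
    corresponding numerator is zero as well, so that both sides vanish. *)
Lemma a_f_path_weight (Sm : Svec n') (Sp : Svec n) :
  a_f H chi Sm Sp t * path_weight H chi Sm Sp =
     #|Spartitions Sp|%:R * #|Spartitions Sm|%:R *
     (chi (mults Sp ++ mults Sm ++ [:: 1%N]) * single_mean *
        (\prod_(j | jump Sp j) upper_moment H (Ydist T th j) (incr Sp j) *
         \prod_(j | jump Sm j) lower_moment H (Zdist T th j) (incr Sm j)) +
      \sum_(j | jump Sp j)
        chi (rem (incr Sp j) (mults Sp) ++ mults Sm ++ [:: (incr Sp j).+1]) *
        joined1 j (incr Sp j) *
        (\prod_(k | jump Sp k && (k != j)) upper_moment H (Ydist T th k) (incr Sp k) *
         \prod_(k | jump Sm k) lower_moment H (Zdist T th k) (incr Sm k)) +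
      \sum_(j | jump Sm j)
        chi (mults Sp ++ rem (incr Sm j) (mults Sm) ++ [:: (incr Sm j).+1]) *
        joined2 j (incr Sm j) *
        (\prod_(k | jump Sp k) upper_moment H (Ydist T th k) (incr Sp k) *
         \prod_(k | jump Sm k && (k != j)) lower_moment H (Zdist T th k) (incr Sm k))).
Proof.
set Pp := \prod_(j | jump Sp j) _; set Pm := \prod_(j | jump Sm j) _.
set D := chi (mults Sp ++ mults Sm).
rewrite path_weightE -/D -/Pp -/Pm [LHS]mulrCA; congr (_ * _).
have jump_in n0 (S : Svec n0) j : is_true (jump S j) -> j \in N1 n0.
  move=> Sj; rewrite !finset.inE; apply: contraTneq Sj => ->.
  rewrite /jump /Sprev /= (_ : inord 0 = ord0) ?ltnn//.
  by apply: ord_inj; rewrite inordK.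
have [D0|D0] := eqVneq D 0.
  rewrite D0 mul0r mulr0.
  have all1 := mults2_gt0 Sp Sm.
  rewrite (@chi_sym _ (1%N :: mults Sp ++ mults Sm)); last 2 first.
  - by rewrite catA all_cat all1.
  - by rewrite catA cats1 perm_rcons.
  rewrite chi_eq0_new// !mul0r add0r big1 ?add0r => [|j Sj]; last first.
    have pm := mem_mults Sj.
    rewrite (@chi_sym _ ((incr Sp j).+1 :: rem (incr Sp j) (mults Sp ++ mults Sm))).
    + by rewrite chi_eq0_join// ?mem_cat ?pm// !mul0r.
    + rewrite catA all_cat /= andbT all_cat mults_gt0 andbT.
      by apply/allP => k /mem_rem; exact: (allP (mults_gt0 Sp)).
    + by rewrite rem_catl// catA cats1 perm_rcons.
  rewrite big1// => j Sj; have pm := mem_mults Sj.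
  rewrite (@chi_sym _ ((incr Sm j).+1 :: rem (incr Sm j) (mults Sm ++ mults Sp))).
  + rewrite chi_eq0_join ?mul0r// ?mem_cat ?pm//; first by rewrite all_cat !mults_gt0.
    by rewrite (@chi_sym _ (mults Sp ++ mults Sm)) ?all_cat ?mults_gt0// perm_catC.
  + rewrite catA all_cat /= andbT all_cat mults_gt0 /=.
    by apply/allP => k /mem_rem; exact: (allP (mults_gt0 Sm)).
  + by rewrite rem_catl// catA cats1 perm_rcons perm_cons perm_catC.
(* The factor of [Pp] at the jump [j] cancels the denominator of [d_plus]. *)
have plus_term j : jump Sp j ->
    eta_plus chi Sm Sp j * d_plus H Sp j t * (th < t)%R%:R * (D * (Pp * Pm)) =
    chi (rem (incr Sp j) (mults Sp) ++ mults Sm ++ [:: (incr Sp j).+1]) *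
    joined1 j (incr Sp j) *
    (\prod_(k | jump Sp k && (k != j)) upper_moment H (Ydist T th k) (incr Sp k) * Pm).
  move=> Sj; rewrite /eta_plus /d_plus Sj -/D /Pp (bigD1 j)//= /joined1.
  set U := upper_moment H (Ydist T th j) _; set V := upper_moment H (Num.max _ _) _.
  have [U0|U0] := eqVneq U 0; last by field; rewrite ?D0 ?U0.
  have V0 : V = 0.
    have jp : (0 < incr Sp j)%N by rewrite /incr subn_gt0.
    rewrite /V -(prednK jp); apply: (@upper_moment_joined_eq0 (Ydist T th j)).
    + by apply: Ydist_gt0; exact: jump_in Sj.
    + by rewrite le_max lexx orbT.
    + by rewrite prednK.
  by rewrite U0 V0 !(mul0r, mulr0).
have minus_term j : jump Sm j ->
    eta_minus chi Sm Sp j * d_minus H Sm j t * (t < th)%R%:R * (D * (Pp * Pm)) =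
    chi (mults Sp ++ rem (incr Sm j) (mults Sm) ++ [:: (incr Sm j).+1]) *
    joined2 j (incr Sm j) *
    (Pp * \prod_(k | jump Sm k && (k != j)) lower_moment H (Zdist T th k) (incr Sm k)).
  move=> Sj; rewrite /eta_minus /d_minus Sj -/D /Pm (bigD1 j)//= /joined2.
  set U := lower_moment H (Zdist T th j) _; set V := lower_moment H (Num.min _ _) _.
  have [U0|U0] := eqVneq U 0; last by field; rewrite ?D0 ?U0.
  have V0 : V = 0.
    have jp : (0 < incr Sm j)%N by rewrite /incr subn_gt0.
    rewrite /V -(prednK jp); apply: (@lower_moment_joined_eq0 (Zdist T th j)).
    + by apply: Zdist_lt0; exact: jump_in Sj.
    + by rewrite ge_min lexx orbT.
    + by rewrite prednK.
  by rewrite U0 V0 !(mul0r, mulr0).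
rewrite -(eq_bigr _ plus_term) -(eq_bigr _ minus_term) -!mulr_suml.
have plus0 : \sum_j eta_plus chi Sm Sp j * d_plus H Sp j t =
    \sum_(j | jump Sp j) eta_plus chi Sm Sp j * d_plus H Sp j t.
  rewrite [RHS]big_mkcond; apply: eq_bigr => j _; rewrite /eta_plus.
  by case: (jump Sp j); rewrite ?mul0r.
have minus0 : \sum_j eta_minus chi Sm Sp j * d_minus H Sm j t =
    \sum_(j | jump Sm j) eta_minus chi Sm Sp j * d_minus H Sm j t.
  rewrite [RHS]big_mkcond; apply: eq_bigr => j _; rewrite /eta_minus.
  by case: (jump Sm j); rewrite ?mul0r.
rewrite /a_f plus0 minus0 /eta0 -/D /single_mean.
by field; rewrite D0.
Qed.

Lemma sum_a_f_path_weight :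
  \sum_(p | finset.partition p (None |: [set Some k | k : 'I_N])%SET) chi (sizes p) *
    \prod_(D in p) cell_mean D =
  \sum_(Sp : Svec n | is_Spath Sp) \sum_(Sm : Svec n' | is_Spath Sm)
    a_f H chi Sm Sp t * path_weight H chi Sm Sp.
Proof.
rewrite -data_split; etransitivity.
  exact: (sum_partition_paths_add_point chi_sym h1inj h2inj dA none_A1 none_A2
    (mom1 := fun j m => upper_moment H (Ydist T th j) m) (ext1 := joined1)
    (mom2 := fun j m => lower_moment H (Zdist T th j) m) (ext2 := joined2)
    cell_mean1 cell_mean2 cell_mean_joined1 cell_mean_joined2 cell_mean_mixed cell_mean_single).
by apply: eq_bigr => Sp _; apply: eq_bigr => Sm _; rewrite a_f_path_weight.
Qed.

End FixedTheta.

(** * Integration over the random measure and the mode *)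

Section Fubini.
Context (R : realType) d (Omega : measurableType d) (P : probability Omega R).
Local Notation measR := (measurableTypeR R).
Local Notation prob := (pprobability measR R).
Local Open Scope ereal_scope.

(** By independence the joint law of the random measure and of the mode is the
    product of their laws, to which the Tonelli theorem applies. *)
Lemma integral_indep (G : {RV P >-> prob}) (theta : {RV P >-> measR}) (prior : probability measR R)
    (F : prob * measR -> \bar R) :
  (forall A : set measR, measurable A -> distribution P theta A = prior A) ->
  indep_RV P G theta -> measurable_fun setT F -> (forall z, 0 <= F z) ->
  \int[P]_w F (G w, theta w) = \int[prior]_th \int[P]_w F (G w, th) /\
  measurable_fun setT (fun th => \int[P]_w F (G w, th)).
Proof.
move=> Hprior Hindep mF F0.
have mGth : measurable_fun setT (fun w => (G w, theta w) : prob * measR).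
  exact: measurable_fun_pair.
pose X : {RV P >-> (prob * measR)%type} := mfun_Sub (mem_set mGth).
have inner th : \int[distribution P G]_mu F (mu, th) = \int[P]_w F (G w, th).
  rewrite ge0_integral_distribution//.
  exact: measurableT_comp.
have eX : \int[P]_w F (G w, theta w) = \int[distribution P G \x prior]_z F z.
  transitivity (\int[distribution P X]_z F z).
    by rewrite ge0_integral_distribution.
  apply/esym/eq_measure_integral => A mA _.
  apply: product_measure_unique => // B C mB mC.
  transitivity (distribution P G B * distribution P theta C); last by rewrite Hprior.
  apply: Hindep.
    by exists B => //; rewrite setTI.
  by exists C => //; rewrite setTI.
split.
  rewrite eX fubini_tonelli2//; apply: eq_integral => th _; exact: inner.
rewrite -(_ : (fun th => \int[distribution P G]_mu F (mu, th)) = fun th => \int[P]_w F (G w, th)).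
  exact: measurable_fun_fubini_tonelli_G.
by apply/funext => th; exact: inner.
Qed.

Definition density (t : R) (z : (prob * measR)%type) : measR :=
  mean (z.1 : probability measR R) (ukern z.2 t).

(** The identity map sends a random measure to a probability kernel, and the
    integral of a jointly measurable function against a kernel is measurable. *)
Lemma measurable_density t : measurable_fun setT (density t).
Proof.
have m1 : measurable_fun setT (fst : prob * measR -> prob) by exact: measurable_fst.
pose l : R.-pker (prob * measR)%type ~> measR := kprobability m1.
apply/measurable_EFinP.
rewrite (_ : EFin \o _ = fun z => \int[l z]_x (ukern z.2 t x)%:E).
  apply: (measurable_fun_integral_finite_kernel
    (fun zx : (prob * measR) * measR => (ukern zx.1.2 t zx.2)%:E) l).
    by move=> z; rewrite lee_fin (bn_ge0 (bounded_nonneg_ukern _ _)).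
  apply/measurable_EFinP; apply: measurable_ukern => //.
  exact: (measurableT_comp measurable_snd measurable_fst).
apply/funext => z /=; exact: (meanE _ (bounded_nonneg_ukern _ _)).
Qed.

End Fubini.

Section Posterior.
Context (R : realType) d (Omega : measurableType d) (P : probability Omega R).
Local Notation measR := (measurableTypeR R).
Context (H : probability measR R) (G : {RV P >-> pprobability measR R}) (chi : seq nat -> R)
  (Hchi : is_eppf H G chi) (nonatomic : forall x : R, H [set x] = 0%E).
Context (N : nat) (T : 'I_N -> R) (th : R).

Definition path_sum (F : Svec (N - npos T th) -> Svec (npos T th) -> R) : R :=
  \sum_(Sp : Svec (npos T th) | is_Spath Sp)
    \sum_(Sm : Svec (N - npos T th) | is_Spath Sm) F Sm Sp.

Lemma prod_density_hit (mu : probability measR R) : hits T th ->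
  \prod_(k < N) mean mu (ukern th (T k)) = 0.
Proof.
move=> /existsP[k /eqP Tk]; rewrite (bigD1 k)//= (_ : mean mu _ = 0) ?mul0r//.
by rewrite -[RHS](mean0 mu); congr (mean mu _); apply/funext => x; rewrite Tk ukern_eq.
Qed.

Let chi_sym e e' : all (leq 1) e -> perm_eq e e' -> chi e = chi e'.
Proof. exact: (chi_perm Hchi). Qed.

Let chi_eq0_new e : all (leq 1) e -> chi e = 0 -> chi (1%N :: e) = 0.
Proof. by move=> e1 /(chi_eq0_addition Hchi nonatomic e1)[]. Qed.

Let chi_eq0_join e m : all (leq 1) e -> m \in e -> chi e = 0 -> chi (m.+1 :: rem m e) = 0.
Proof. by move=> e1 me /(chi_eq0_addition Hchi nonatomic e1)[_]; exact. Qed.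

Let chi_eq0_cat e e' : all (leq 1) e -> all (leq 1) e' -> chi e = 0 -> chi (e ++ e') = 0.
Proof. exact: (chi_eq0_cat Hchi nonatomic). Qed.

(** For a mode that is one of the observations both sides are zero; otherwise
    the partitions of the sample are grouped by paths. *)
Lemma expected_likelihood :
  (\int[P]_w (\prod_(k < N) mean (G w) (ukern th (T k)))%:E =
   (path_sum (fun Sm Sp => path_weight H chi Sm Sp))%:E)%E.
Proof.
have [hit|nhit] := boolP (hits T th).
  rewrite integral0_eq; last by move=> w _; rewrite prod_density_hit.
  rewrite /path_sum big1// => Sp _; apply: big1 => Sm _.
  by rewrite /path_weight hit.
rewrite /path_sum -(sum_path_weight H 0 nhit chi_sym chi_eq0_cat).
pose g (i : option 'I_N) := ukern th (if i is Some k then T k else 0).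
rewrite -(eppf_mean Hchi _ (g := g)); last by move=> i; exact: bounded_nonneg_ukern.
apply: eq_integral => w _; congr EFin; rewrite big_imset/=.
  by apply: eq_bigl => k; rewrite finset.inE.
by move=> i j _ _ [].
Qed.

Lemma expected_density_likelihood t :
  (\int[P]_w (mean (G w) (ukern th t) * \prod_(k < N) mean (G w) (ukern th (T k)))%:E =
   (path_sum (fun Sm Sp => a_f H chi Sm Sp t * path_weight H chi Sm Sp))%:E)%E.
Proof.
have [hit|nhit] := boolP (hits T th).
  rewrite integral0_eq; last by move=> w _; rewrite prod_density_hit// mulr0.
  rewrite /path_sum big1// => Sp _; apply: big1 => Sm _.
  by rewrite /path_weight hit mulr0.
rewrite /path_sum -(sum_a_f_path_weight H t nhit chi_sym chi_eq0_new chi_eq0_join chi_eq0_cat).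
pose g (i : option 'I_N) := ukern th (if i is Some k then T k else t).
rewrite -(eppf_mean Hchi _ (g := g)); last by move=> i; exact: bounded_nonneg_ukern.
apply: eq_integral => w _; congr EFin; rewrite big_setU1/=; last by apply/imsetP => -[].
rewrite big_imset/=; last by move=> i j _ _ [].
by congr (_ * _); apply: eq_bigl => k; rewrite finset.inE.
Qed.

End Posterior.

(** * The posterior mean *)

Unset Implicit Arguments.
Set Strict Implicit.

Local Open Scope ring_scope.

Theorem theorem2p6
  (R : realType)
  (d : measure_display) (Omega : measurableType d) (P : probability Omega R)
  (K : set nat) (W xi : nat -> {RV P >-> measurableTypeR R})
  (H : probability (measurableTypeR R) R)
  (G : {RV P >-> pprobability (measurableTypeR R) R})
  (HG : species_sampling K W xi H G)
  (chi : seq nat -> R) (Hchi : is_eppf H G chi)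
  (prior : probability (measurableTypeR R) R)
  (theta : {RV P >-> measurableTypeR R})
  (Hprior : forall A : set (measurableTypeR R),
      measurable A -> distribution P theta A = prior A)
  (Hindep : indep_RV P G theta)
  (N : nat) (T : 'I_N -> R) (HT : injective T)
  (Hmarg : (0 < marginal_density G theta T < +oo)%E)
  (t : R) :
  (posterior_mean G theta T (fun w => unimodal_density (G w) (theta w) t) =
   \int[prior]_th
     \sum_(Sp : Svec (npos T th) | is_Spath Sp)
     \sum_(Sm : Svec (N - npos T th) | is_Spath Sm)
       (a_f H chi Sm Sp t)%:E * path_posterior H prior chi Sm Sp)%E.

Proof.
have nonatomic := ss_nonatomic HG.
pose L (z : pprobability (measurableTypeR R) R * measurableTypeR R) : R :=
  \prod_(k < N) density (T k) z.
have L0 z : 0 <= L z.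
  apply: prodr_ge0 => k _; apply: mean_ge0; exact: (bn_ge0 (bounded_nonneg_ukern _ _)).
have mL : measurable_fun setT (L : _ -> measurableTypeR R).
  by apply: measurable_bigprod => k _; exact: measurable_density.
pose D (z : pprobability (measurableTypeR R) R * measurableTypeR R) : R := density t z * L z.
have D0 z : 0 <= D z.
  rewrite mulr_ge0//; apply: mean_ge0; exact: (bn_ge0 (bounded_nonneg_ukern _ _)).
have mD : measurable_fun setT (D : _ -> measurableTypeR R).
  by apply: measurable_funM => //; exact: measurable_density.
have [eL _] := @integral_indep R d Omega P G theta prior (fun z => (L z)%:E) Hprior Hindep
  (iffRL (measurable_EFinP _ _) mL) (fun z => L0 z).
have [eD mDP] := @integral_indep R d Omega P G theta prior (fun z => (D z)%:E) Hprior Hindep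
  (iffRL (measurable_EFinP _ _) mD) (fun z => D0 z).
(* The normalising constant of the paths is the marginal density of the data. *)
have norm : path_norm H prior chi T = marginal_density G theta T.
  rewrite /marginal_density [RHS]eL /path_norm; apply: eq_integral => th _.
  by rewrite /L /density /= (expected_likelihood Hchi nonatomic).
have Dth th : (\int[P]_w (D (G w, th))%:E =
    (path_sum (T := T) (th := th) (fun Sm Sp => a_f H chi Sm Sp t * path_weight H chi Sm Sp))%:E)%E.
  rewrite -(expected_density_likelihood Hchi nonatomic T th t).
  by apply: eq_integral => w _.
have [c c0 cE] : exists2 c : R, 0 < c & marginal_density G theta T = c%:E.
  move: Hmarg; case: (marginal_density G theta T) => [r||] /andP[]// r0 _.
  by exists r; rewrite // -lte_fin.
have cV : (c%:E^-1 = (c^-1)%:E)%E by rewrite inver gt_eqF.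
rewrite /posterior_mean cE cV.
transitivity ((\int[prior]_th \int[P]_w (D (G w, th))%:E) * (c^-1)%:E)%E.
  by rewrite -eD.
rewrite -ge0_integralZr//; last 2 first.
- by move=> th _; apply: integral_ge0 => w _; rewrite lee_fin.
- by rewrite lee_fin invr_ge0 ltW.
apply: eq_integral => th _; rewrite Dth -EFinM /path_sum mulr_suml -sumEFin.
apply: eq_bigr => Sp _; rewrite mulr_suml -sumEFin; apply: eq_bigr => Sm _.
by rewrite /path_posterior norm cE cV -!EFinM mulrA.
Qed.
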